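(* Let $\ell$ be a prime, let $V$ be a finite-dimensional $\mathbb{F}_\ell$-vector space together with a perfect bilinear pairing $V\times V\to\mathbb{F}_\ell$, and let $G\leq \mathrm{GL}(V)$ be an irreducible primitive subgroup which preserves the pairing. (i) If the pairing is symmetric, $G$ contains a reflection and an isotropic shear, and $\ell\geq 5$, then $G$ is one of the following: (1) the full orthogonal group $O(V)$; (2) the kernel of the spinor norm on $O(V)$; (3) the kernel of the product of the spinor norm and the determinant on $O(V)$. (ii) If the pairing is alternating, $G$ contains a transvection, and $\ell\geq 3$, then $G$ is all of the symplectic group $\mathrm{Sp}(V)$.
   Context: Let $\Gamma\le \mathrm{GL}(V)$ be the group of isometries of the pairing; it is denoted $O(V)$ if the pairing is symmetric and $\mathrm{Sp}(V)$ if it is alternating. For $\gamma\in\Gamma$, the drop of $\gamma$ is the codimension in $V$ of the fixed space $V^{\gamma=1}$. An element of $\Gamma$ of drop $1$ is a reflection if its determinant is $-1$ and a transvection if its determinant is $1$. An isotropic shear is a non-trivial unipotent element $\sigma\in\Gamma$ with $(\sigma-1)^2=0$. A subgroup $G\le\Gamma$ is irreducible if $V$ is an irreducible $G$-representation; it is imprimitive if $V$, as a $G$-representation, is induced from a proper subgroup of $G$, and primitive otherwise. The spinor norm is the homomorphism $O(V)\to\mathbb{F}_\ell^\times/\mathbb{F}_\ell^{\times 2}\cong\{\pm1\}$ sending the reflection with root $v$ (a generator of its $(-1)$-eigenspace) to the class of $\langle v,v\rangle$; its product with the determinant is formed in $\{\pm 1\}$. *)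

(* Defs.v *)
From HB Require Import structures.
From mathcomp Require Import all_boot all_order all_algebra all_fingroup.
From mathcomp Require Import all_solvable all_field all_character.
From mathcomp Require Import zify ring.

Set Implicit Arguments.
Unset Strict Implicit.
Unset Printing Implicit Defensive.

Import GRing.Theory.
Local Open Scope ring_scope.

(* Vectors are rows and matrices act on the right, as in mxrepresentation; the
   groups act on the nonzero space 'rV[F]_n.+1.                               *)

Section Representations.

Variables (F : fieldType) (gT : finGroupType) (G : {group gT}) (n : nat).
Variable rG : mx_representation F G n.

(* V is induced from H when it is the direct sum of the translates of an
   H-stable subspace W over the cosets of H in G. Since the action is on the
   right these are right cosets H :* x, and W *m rG x depends only on H :* x. *)
Definition induced_from (H : {group gT}) : Prop :=
  exists W : 'M[F]_n,
    [/\ {in H, forall h, (W *m rG h <= W)%MS},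
        mxdirect (\sum_(A in rcosets H G) (W *m rG (repr A)))%MS
      & (\sum_(A in rcosets H G) (W *m rG (repr A)) == 1%:M)%MS].

Definition mx_imprimitive : Prop :=
  exists2 H : {group gT}, H \proper G & induced_from H.

Definition mx_primitive : Prop := ~ mx_imprimitive.

End Representations.

Section NaturalRepresentation.

Variables (F : finFieldType) (n : nat) (G : {group {'GL_n.+1[F]}}).

Definition natural_repr : mx_representation F G n.+1 :=
  subg_repr (GLrepr F n) (subsetT G).

End NaturalRepresentation.

Section Pairings.

Variables (F : finFieldType) (n : nat).
Notation V := 'rV[F]_n.+1.
Notation GL := {'GL_n.+1[F]}.
Implicit Types (b : V -> V -> F) (g h : GL) (u v : V).

Definition perfect_pairing b : Prop :=
  (forall phi : {scalar V}, exists! u, forall v, b u v = phi v) /\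
  (forall phi : {scalar V}, exists! v, forall u, b u v = phi u).

Definition symmetric_pairing b : Prop := forall u v, b u v = b v u.

Definition alternating_pairing b : Prop := forall v, b v v = 0.

Definition isom_set b : {set GL} :=
  [set g : GL | [forall u : V, forall v : V, b (u *m g) (v *m g) == b u v]].

Lemma isom_setP b g :
  reflect (forall u v, b (u *m g) (v *m g) = b u v) (g \in isom_set b).
Proof.
rewrite inE; apply: (iffP forallP) => [bg u v|bg u].
  by move/forallP: (bg u) => /(_ v)/eqP.
by apply/forallP=> v; rewrite bg.
Qed.

Fact isom_group_set b : group_set (isom_set b).
Proof.
apply/group_setP; split=> [|g h /isom_setP bg /isom_setP bh].
  by apply/isom_setP=> u v; rewrite GL_1E !mulmx1.
by apply/isom_setP=> u v; rewrite GL_MxE !mulmxA bh bg.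
Qed.

Canonical isom_group b : {group GL} := group (isom_group_set b).

Definition drop_of g : nat := n.+1 - \rank (eigenspace (GLval g) 1).

Definition is_reflection b g : bool :=
  [&& g \in isom_group b, drop_of g == 1%N & \det (GLval g) == -1].

Definition is_transvection b g : bool :=
  [&& g \in isom_group b, drop_of g == 1%N & \det (GLval g) == 1].

Definition unipotent g : Prop := exists k, (GLval g - 1) ^+ k = 0.

Definition is_isotropic_shear b g : Prop :=
  [/\ g \in isom_group b, g != 1%g, unipotent g & (GLval g - 1) ^+ 2 = 0].

Definition root_of g v : bool :=
  (v != 0) && (v == eigenspace (GLval g) (-1))%MS.

(* F^* / (F^* )^2, for F of odd characteristic, realized as {1, -1} in F. *)
Definition square_class (a : F) : F :=
  if [exists c : F, c ^+ 2 == a] then 1 else -1.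

(* The last clause only fixes irrelevant values, off the isometry group. *)
Definition is_spinor_norm b (f : GL -> F) : bool :=
  [&& [forall g in isom_group b, (f g == 1) || (f g == -1)],
      [forall g in isom_group b, forall h in isom_group b,
         f (g * h)%g == f g * f h],
      [forall g : GL, forall v : V,
         is_reflection b g && root_of g v ==> (f g == square_class (b v v))]
    & [forall g : GL, (g \notin isom_group b) ==> (f g == 1)]].

(* For b symmetric and perfect in odd characteristic, this is the map satisfying
   is_spinor_norm: it exists by spinor_normP below, and it is unique because
   reflections generate the orthogonal group.                                 *)
Definition spinor_norm b : GL -> F :=
  odflt [ffun=> 1] [pick f : {ffun GL -> F} | is_spinor_norm b f].

Definition spinor_kernel b : {set GL} :=
  [set g in isom_group b | spinor_norm b g == 1].

Definition spinor_det_kernel b : {set GL} :=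
  [set g in isom_group b | spinor_norm b g * \det (GLval g) == 1].

End Pairings.

(* Existence of the spinor norm: it is the sign of the permutation induced by an
   isometry on the sphere of all x with b x x = c, for any nonsquare c. For the
   reflection r with root v, this counts the pairs {x, x *m r} of distinct points
   modulo 2; negation acts on these pairs, and fixes only those on the line of v. *)
Section SpinorNormExists.

Lemma odd_perm_involutive (T : finType) (A : {set T}) (s : {perm T}) :
    involutive s -> {in A, forall x, s x \notin A} ->
    (forall x, s x != x -> (x \in A) || (s x \in A)) ->
  odd_perm s = odd #|A|.
Proof.
have [m] := ubnP #|A|; elim: m A s => // m IHm A s /ltnSE-leAm sK sA mvA.
have [A0 | [a Aa]] := set_0Vmem A.
  rewrite A0 cards0; suff ->: s = 1%g by rewrite odd_perm1.
  apply/permP=> x; rewrite perm1; apply/eqP; apply: contraT => /mvA.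
  by rewrite A0 !inE.
have nsa: s a != a by apply: contraNneq (sA a Aa) => ->.
pose s' := (tperm a (s a) * s)%g.
have s'E x : s' x = if (x == a) || (x == s a) then x else s x.
  rewrite permM; case: tpermP => [->|->|/eqP/negPf-> /eqP/negPf->] //.
    by rewrite sK eqxx.
  by rewrite eqxx orbT.
have{} IHm: odd_perm s' = odd #|A :\ a|.
  apply: IHm => [|x|x|x].
  - by rewrite (leq_trans _ leAm) // [X in (_ < X)%N](cardsD1 a) Aa.
  - rewrite (s'E x); case: ifP => xa; rewrite s'E ?xa //.
    by rewrite (can2_eq sK sK) (inj_eq perm_inj) orbC xa sK.
  - rewrite !inE s'E => /andP[xa Ax]; rewrite (negPf xa) /=.
    have ->: x == s a = false by apply: contraNF (sA a Aa) => /eqP <-.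
    by rewrite negb_and sA ?orbT.
  - rewrite !s'E; case: ifP => [|/norP[xa xsa] /mvA]; first by rewrite eqxx.
    by rewrite !inE xa (can2_eq sK sK) xsa.
by rewrite (cardsD1 a) Aa /= -IHm odd_permM odd_tperm eq_sym nsa addTb negbK.
Qed.

Lemma odd_card_involutive (T : finType) (A : {set T}) (t : T -> T) :
    involutive t -> {in A, forall x, t x \in A} ->
  odd #|A| = odd #|[set x in A | t x == x]|.
Proof.
have [m] := ubnP #|A|; elim: m A => // m IHm A /ltnSE-leAm tK tA.
have [/existsP[x /andP[Ax tx]] | ] := boolP [exists x in A, t x != x].
  have tx' : t x \in A :\ x by rewrite !inE tx tA.
  rewrite (cardsD1 x) Ax (cardsD1 (t x)) tx' /= negbK.
  rewrite (IHm (A :\ x :\ t x)) => [|||y] //.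
  - congr (odd _); apply: eq_card => y; rewrite !inE.
    case: (eqVneq y (t x)) => [->|_] /=; first by rewrite tK eq_sym (negPf tx) andbF.
    by case: (eqVneq y x) => [->|_] //=; rewrite (negPf tx) andbF.
  - apply: leq_trans leAm.
    by rewrite [X in (_ < X)%N](cardsD1 x) Ax (cardsD1 (t x) (A :\ x)) tx' ltnS leqnSn.
  - rewrite !inE => /and3P[ytx yx Ay].
    by rewrite (inj_eq (can_inj tK)) yx (can2_eq tK tK) ytx tA.
rewrite negb_exists => /forallP tfix; congr (odd _).
apply: eq_card => x; rewrite !inE; have:= tfix x.
by rewrite negb_and negbK; case: (x \in A).
Qed.

Variables (F : finFieldType) (n : nat).
Notation V := 'rV[F]_n.+1.
Notation GL := {'GL_n.+1[F]}.

Lemma square_class_sqr (c : F) : square_class (c ^+ 2) = 1.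
Proof. by rewrite /square_class; case: existsP => // -[]; exists c. Qed.

Lemma nonsquare_exists :
  2 != 0 :> F -> exists c : F, forall x, x ^+ 2 != c.
Proof.
move=> F2; have [/existsP[c /forallP]|] :=
  boolP [exists c : F, forall x : F, x ^+ 2 != c]; first by exists c.
rewrite negb_exists => /forallP sqF; case/negP: F2.
have ontoF c : exists x : F, x ^+ 2 == c.
  by have:= sqF c; rewrite negb_forall => /existsP[x];
     rewrite negbK; exists x.
pose r c := xchoose (ontoF c).
have rK: cancel r (fun x => x ^+ 2) by move=> c; apply/eqP/(xchooseP (ontoF c)).
have: 1 = - 1 :> F by apply: (can_inj (canF_sym rK)); rewrite sqrrN.
by move/eqP; rewrite -addr_eq0.
Qed.

Lemma square_mul_nonsquare (a c : F) :
    (forall x, x ^+ 2 != a) -> (forall x, x ^+ 2 != c) ->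
  exists x, x ^+ 2 = a * c.
Proof.
move=> nsqa nsqc.
have nz d: (forall x : F, x ^+ 2 != d) -> d \is a @GRing.unit F.
  move=> nsqd; rewrite unitfE; have:= nsqd 0; rewrite expr0n eq_sym.
  exact.
have /cyclicP[z defU] := field_unit_group_cyclic [set: {unit F}].
have oddX d (Ud : d \is a GRing.unit) : (forall x, x ^+ 2 != d) ->
    exists2 i, odd i & d = (val z) ^+ i.
  move=> nsqd; have: FinRing.unit F Ud \in <[z]>%g by rewrite -defU inE.
  case/cycleP=> i def_d; have{def_d} def_d: d = val z ^+ i.
    by rewrite -(FinRing.val_unitX i z) -def_d.
  exists i => //; apply: contraT => even_i.
  by have:= nsqd (val z ^+ i./2); rewrite -exprM muln2 halfK (negPf even_i) subn0 -def_d eqxx.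
have [i odd_i ->] := oddX a (nz a nsqa) nsqa.
have [j odd_j ->] := oddX c (nz c nsqc) nsqc.
exists (val z ^+ (i + j)./2).
by rewrite -exprM muln2 halfK oddD odd_i odd_j subn0 exprD.
Qed.


Variable b : {biscalar V}.
Hypotheses (F2 : 2 != 0 :> F) (bP : perfect_pairing b).

Lemma perfect_nondegenerate v : (forall u, b u v = 0) -> v = 0.
Proof.
move=> bv0; have [w [_ uniqw]] := bP.2 (\0 : {scalar V}).
by rewrite -(uniqw v) // (uniqw 0) // => u; rewrite linear0r.
Qed.

Let opp_eq0 (a : F) : a = - a -> a = 0.
Proof.
move/eqP; rewrite -addr_eq0 -mulr2n -mulr_natr mulf_eq0 (negPf F2) orbF.
by move/eqP.
Qed.

Section Reflection.

Variables (r : GL) (v : V).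
Hypotheses (r_refl : is_reflection b r) (r_root : root_of r v).

Lemma refl_isom x y : b (x *m r) (y *m r) = b x y.
Proof. by case/and3P: r_refl => /isom_setP. Qed.

Lemma refl_root : v *m r = - v.
Proof.
have [_ /andP[sv _]] := andP r_root.
by rewrite (eigenspaceP sv) scaleN1r.
Qed.

Lemma refl_opp x : x *m r = - x -> exists k, x = k *: v.
Proof.
have [_ /andP[_ sE]] := andP r_root.
move=> xr; apply/sub_rVP; apply: submx_trans sE.
by apply/eigenspaceP; rewrite scaleN1r.
Qed.

Lemma refl_decomp x : exists w k, w *m r = w /\ x = w + k *: v.
Proof.
have [nzv _] := andP r_root; have /and3P[_ /eqP rkE _] := r_refl.
have rE1 : \rank (eigenspace (GLval r) 1) = n.
  have: (\rank (eigenspace (GLval r) 1) <= n.+1)%N by apply: rank_leq_row.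
  by move: rkE; rewrite /drop_of; case: ltngtP => //; lia.
have dxv: (eigenspace (GLval r) 1 :&: v = 0)%MS.
  apply/eqP/rowV0P=> y; rewrite sub_capmx => /andP[/eigenspaceP yr /sub_rVP[k Dy]].
  have{yr} yN: y = - y.
    by move: yr; rewrite {1}Dy -scalemxAl refl_root scale1r scalerN -Dy.
  apply/rowP=> i; rewrite [RHS]mxE; apply: opp_eq0.
  by rewrite {1}yN mxE.
have full: row_full (eigenspace (GLval r) 1 + v)%MS.
  by rewrite /row_full mxrank_disjoint_sum // rE1 rank_rV nzv addn1.
have /sub_addsmxP[[w k] /= ->] := submx_full x full.
exists (w *m eigenspace (GLval r) 1), (k 0 0); split.
  by have /eigenspaceP := submxMl w (eigenspace (GLval r) 1); rewrite scale1r.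
by rewrite -mul_scalar_mx -mx11_scalar.
Qed.

Lemma refl_fix_orth w : w *m r = w -> b w v = 0.
Proof. by move=> rw; apply: opp_eq0; rewrite -{1}refl_isom rw refl_root linearNr. Qed.

Lemma refl_root_anisotropic : b v v != 0.
Proof.
have [nzv _] := andP r_root; apply: contraNneq nzv => bv0.
apply/eqP/perfect_nondegenerate => x; have [w [k [rw ->]]] := refl_decomp x.
by rewrite linearDl linearZl_LR /= bv0 refl_fix_orth // mulr0 addr0.
Qed.

Lemma refl_moved x : (x *m r == x) = (b x v == 0).
Proof.
apply/eqP/eqP=> [/refl_fix_orth //|]; have [w [k [rw ->]]] := refl_decomp x.
rewrite linearDl linearZl_LR /= refl_fix_orth // add0r => /eqP.
rewrite mulf_eq0 (negPf refl_root_anisotropic) orbF => /eqP->.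
by rewrite scale0r addr0.
Qed.

Lemma reflK : involutive (fun x : V => x *m r).
Proof.
move=> x; have [w [k [rw ->]]] := refl_decomp x.
by rewrite !mulmxDl -!scalemxAl !rw refl_root mulNmx refl_root opprK.
Qed.

End Reflection.

Section SignOnSphere.

Variable c : F.
Hypothesis nsqc : forall x, x ^+ 2 != c.

Definition sphere_act (g : GL) (x : V) : V :=
  if (g \in isom_group b) && (b x x == c) then x *m g else x.

Lemma sphere_act_inj g : injective (sphere_act g).
Proof.
move=> x y; rewrite /sphere_act; case: ifP => [/andP[Gg xc]|nx];
  case: ifP => [/andP[Gg' yc]|ny] // Dxy.
- by apply: (can_inj (mulmxK (GL_unitmx g))).
- by move: ny; rewrite -Dxy (isom_setP _ _ Gg) xc Gg.
- by move: nx; rewrite Dxy (isom_setP _ _ Gg') yc Gg'.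
Qed.

Definition sphere_perm g := perm (@sphere_act_inj g).

Lemma sphere_permM : {in isom_group b &, {morph sphere_perm : g h / (g * h)%g}}.
Proof.
move=> g h Gg Gh; apply/permP=> x; rewrite permM !permE /sphere_act groupM // Gg Gh /=.
case xc: (b x x == c); last by rewrite xc.
by rewrite (isom_setP _ _ Gg) xc -mulmxA.
Qed.

Lemma odd_sphere_perm r v :
  is_reflection b r -> root_of r v ->
  odd_perm (sphere_perm r) = [forall x : F, x ^+ 2 != b v v].
Proof.
move=> r_refl r_root; have [Gr _ _] := and3P r_refl.
have sE x : sphere_perm r x = if b x x == c then x *m r else x.
  by rewrite permE /sphere_act Gr.
have rK := reflK r_refl r_root; have bI := refl_isom r_refl.
have bNv x : b (x *m r) v = - b x v.
  by rewrite -[v in LHS]opprK -(refl_root r_root) linearNr bI.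
pose P (t : F) := (enum_rank t < enum_rank (- t))%N.
have PN t : t != 0 -> P (- t) = ~~ P t.
  move=> nz_t; rewrite /P opprK -leqNgt ltn_neqAle.
  rewrite (inj_eq val_inj) (inj_eq enum_rank_inj).
  suff ->: - t != t by [].
  by apply: contraNneq nz_t => tN; apply/eqP/opp_eq0.
have P0 : ~~ P 0 by rewrite /P oppr0 ltnn.
pose A := [set x : V | (b x x == c) && P (b x v)].
have ->: odd_perm (sphere_perm r) = odd #|A|.
  apply: odd_perm_involutive => [x|x|x]; rewrite ?inE (sE x).
  - by case: ifP => xc; rewrite sE ?bI xc ?rK.
  - case/andP=> xc Px; rewrite xc bI xc /= bNv PN ?negbK //.
    by apply: contraTneq Px => ->.
  - case: ifP => [xc|_]; last by rewrite eqxx.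
    rewrite (refl_moved r_refl r_root) bI xc /= bNv => /PN->.
    exact: orbN.
have nza := refl_root_anisotropic r_refl r_root.
pose t (x : V) := - (x *m r).
have tK : involutive t by move=> x; rewrite /t mulNmx rK opprK.
rewrite (odd_card_involutive tK) => [|x]; last first.
  by rewrite !inE /t linearNl linearNr opprK bI linearNl bNv opprK.
pose B := [set k : F | (k ^+ 2 * b v v == c) && P (k * b v v)].
have nzv : v != 0 by case/andP: r_root.
have ->: [set x in A | t x == x] = [set k *: v | k in B].
  apply/setP=> x; rewrite !inE; apply/andP/imsetP.
    case=> /andP[xc Px] /eqP tx.
    have [k Dx] : exists k, x = k *: v.
      by apply: (refl_opp r_root); rewrite -{2}tx opprK.
    exists k => //; move: xc Px; rewrite Dx inE linearZl_LR linearZr_LR linearZl_LR /=.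
    by rewrite mulrA -expr2 => -> ->.
  case=> k; rewrite inE => /andP[kc Pk] ->.
  rewrite /t -scalemxAl (refl_root r_root) scalerN opprK eqxx.
  by rewrite linearZl_LR linearZr_LR linearZl_LR /= mulrA -expr2 kc Pk.
have kv_inj : injective (fun k => k *: v).
  move=> k1 k2 /eqP; rewrite -subr_eq0 -scalerBl scaler_eq0 (negPf nzv) orbF.
  by rewrite subr_eq0 => /eqP.
rewrite card_imset //; case: forallP => [nsqa | sqa]; last first.
  suff ->: B = set0 by rewrite cards0.
  apply/setP=> k; rewrite !inE; apply/negP=> /andP[/eqP kc _]; case: sqa => x.
  apply: contraT; rewrite negbK => /eqP xa.
  by have:= nsqc (k * x); rewrite exprMn xa kc eqxx.
have [e De] := square_mul_nonsquare nsqa nsqc.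
have nzc : c != 0 by have:= nsqc 0; rewrite expr0n eq_sym.
have nze : e != 0.
  by have:= mulf_neq0 nza nzc; rewrite -De expf_eq0.
pose k0 := if P e then e / b v v else - e / b v v.
suff ->: B = [set k0] by rewrite cards1.
apply/setP=> k; rewrite !inE; apply/andP/eqP.
  case=> /eqP kc Pk; have: (k * b v v) ^+ 2 = e ^+ 2.
    by rewrite De -kc exprMn; ring.
  move/eqP; rewrite eqf_sqr => /orP[]/eqP Dk; move: Pk; rewrite Dk.
    by rewrite /k0 => ->; rewrite -Dk mulfK.
  by rewrite PN // /k0 => /negPf->; rewrite -Dk mulfK.
have Dk0: (k0 * b v v) ^+ 2 = e ^+ 2.
  by rewrite /k0; case: ifP; rewrite divfK ?sqrrN.
move=> ->; split; last by rewrite /k0; case: ifP => Pe; rewrite divfK ?PN ?Pe.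
by apply/eqP; apply: (mulfI nza); rewrite -De -Dk0; ring.
Qed.

End SignOnSphere.

Lemma spinor_normP : is_spinor_norm b (spinor_norm b).
Proof.
rewrite /spinor_norm; case: pickP => //= no_spin.
have [c nsqc] := nonsquare_exists F2.
pose f : {ffun GL -> F} := [ffun g : GL =>
  if g \in isom_group b then (-1) ^+ odd_perm (sphere_perm c g) else 1].
suff: is_spinor_norm b f by rewrite no_spin.
apply/and4P; split.
- apply/forall_inP=> g Gg; rewrite ffunE Gg.
  by case: odd_perm; rewrite eqxx ?orbT.
- apply/forall_inP=> g Gg; apply/forall_inP=> h Gh.
  by rewrite !ffunE groupM // Gg Gh sphere_permM // odd_permM signr_addb.
- apply/forallP=> g; apply/forallP=> v; apply/implyP=> /andP[g_refl g_root].
  have [Gg _ _] := and3P g_refl; rewrite ffunE Gg (odd_sphere_perm nsqc g_refl g_root).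
  rewrite /square_class; case: forallP => [nsq | sq]; case: existsP => //.
    by case=> x /eqP xv; have:= nsq x; rewrite xv eqxx.
  by case; apply/existsP; apply: contra_notT sq; rewrite negb_exists => /forallP.
- by apply/forallP=> g; apply/implyP=> nGg; rewrite ffunE (negPf nGg).
Qed.

End SpinorNormExists.

(* Main.v *)
Require Import Defs.
From HB Require Import structures.
From mathcomp Require Import all_boot all_order all_algebra all_fingroup.
From mathcomp Require Import all_solvable all_field all_character.
From mathcomp Require Import zify ring.

Set Implicit Arguments.
Unset Strict Implicit.
Unset Printing Implicit Defensive.

Import GRing.Theory.
Local Open Scope ring_scope.

(** Both parts study a G-stable set of roots: the roots of all the transvections
    of G, or the vectors of a fixed norm whose reflections are in G. Two roots are
    joined when they are not orthogonal. The spans of the connected components are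
    pairwise orthogonal and permuted by G, so V is induced from the stabilizer of
    one of them; as G is primitive, the roots are connected
    ([primitive_connected]). They also span V, as G is irreducible.

    Alternating case. As F_l is a prime field, a transvection of G brings all those
    with the same root, and two nonorthogonal roots u, v give the roots u + c v.
    By connectedness any two roots have a common neighbour, and it follows that the
    roots form with 0 a subspace, so that every nonzero vector is a root
    ([primitive_transvections]). Transvections generate Sp(V)
    ([transvections_generate]).

    Symmetric case. Let a be the norm of the root of a reflection of G, and N the
    subgroup generated by the reflections of G with roots of norm a. The shear
    moves some root v, say to v + e; then e is isotropic and orthogonal to v, and
    the product of the reflections of v and v + e is an Eichler transformation
    E_{e,y}, with y a multiple of v. Conjugating it by a root that is not
    orthogonal to e produces a hyperbolic pair e, f and a root w orthogonal to both
    such that E_{e,w} and E_{f,w} are in N ([shear_frame]). Next, let y be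
    the projection onto the orthogonal of e, f, w of any root that is not itself
    in this orthogonal; then E_{e,y} is in N ([root_comp_siegel]). This comes down
    to finding a point on a conic, and is where l >= 5 matters. By connectedness
    this extends to all roots, so N contains all the transformations E_{e,y} and
    E_{f,y} ([frame_siegel]), hence all the reflections of norm a ([norm_root]) and
    all Eichler transformations ([isotropic_siegel]).

    Finally, let r be a reflection whose root has a norm in the other class modulo
    squares. Any isometry can be turned into the identity by multiplying it by
    reflections and Eichler transformations that make it fix more and more vectors,
    and any two reflections of the class of r have a product in N, so O(V) is the
    union of N and N r ([orthogonal_cosets]). Either the spinor norm or its product
    with the determinant is 1 on N and -1 on r; so N is its kernel, and G, which
    contains N, is N or O(V). *)

(** * Groups acting by prescribed maps *)

Section Realization.

Variables (F : finFieldType) (n : nat).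
Notation V := 'rV[F]_n.+1.
Notation GL := {'GL_n.+1[F]}.
Implicit Types (G N : {group GL}) (g h : GL) (phi psi : V -> V) (x y : V).

Lemma mulGL g h x : x *m GLval (g * h)%g = x *m GLval g *m GLval h.
Proof. by rewrite GL_MxE mulmxA. Qed.

Lemma mulGL1 x : x *m GLval (1%g : GL) = x.
Proof. by rewrite GL_1E mulmx1. Qed.

Lemma mulGLK g x : x *m GLval g *m GLval g^-1%g = x.
Proof. by rewrite -mulGL mulgV mulGL1. Qed.

Lemma mulGLVK g x : x *m GLval g^-1%g *m GLval g = x.
Proof. by rewrite -mulGL mulVg mulGL1. Qed.

Lemma GL_ext g h : (forall x, x *m GLval g = x *m GLval h) -> g = h.
Proof. by move=> gh; apply/val_inj/row_matrixP => i; rewrite !rowE gh. Qed.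

(** Group elements are handled through the maps that they induce: to know that a
    group contains a certain reflection is to know that it realizes a formula. *)
Definition realized N phi : bool :=
  [exists g in N, [forall x : V, x *m GLval g == phi x]].

Lemma realizedP N phi :
  reflect (exists2 g, g \in N & forall x, x *m GLval g = phi x) (realized N phi).
Proof.
apply: (iffP exists_inP) => -[g Ng gE]; exists g => //.
  by move=> x; apply/eqP; apply: (forallP gE).
by apply/forallP=> x; rewrite gE.
Qed.

Lemma eq_realized N phi psi : phi =1 psi -> realized N phi -> realized N psi.
Proof.
by move=> eq_f /realizedP[g Ng gE]; apply/realizedP; exists g => // x; rewrite gE.
Qed.

Lemma realized_id N : realized N id.
Proof. by apply/realizedP; exists 1%g => // x; rewrite mulGL1. Qed.

Lemma realized_inv N g : g \in N -> realized N (fun x => x *m GLval g^-1%g).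
Proof. by move/groupVr=> Vg; apply/realizedP; exists g^-1%g. Qed.

Lemma realized_comp N phi psi :
  realized N phi -> realized N psi -> realized N (psi \o phi).
Proof.
move=> /realizedP[g Ng gE] /realizedP[h Nh hE]; apply/realizedP.
by exists (g * h)%g => [|x]; rewrite ?groupM // mulGL gE hE.
Qed.

Lemma realizedJ N g phi psi :
    g \in 'N(N)%g -> (forall x, psi (x *m GLval g) = phi x *m GLval g) ->
  realized N phi -> realized N psi.
Proof.
move=> nNg psiE /realizedP[h Nh hE]; apply/realizedP.
exists (h ^ g)%g => [|x]; first by rewrite memJ_norm.
by rewrite conjgE mulGL mulGL hE -psiE mulGLVK.
Qed.

Lemma involutive_GL phi :
  linear phi -> involutive phi -> exists g, forall x, x *m GLval g = phi x.
Proof.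
move=> phiL phiK.
pose f : {linear V -> V} := HB.pack phi (GRing.isLinear.Build F V V _ phi phiL).
have AA : lin1_mx f *m lin1_mx f = 1%:M.
  by apply/row_matrixP=> i; rewrite !rowE mulmxA !mul_rV_lin1 /= phiK mulmx1.
by exists (FinRing.unit _ (mulmx1_unit AA).1 : GL) => x; rewrite mul_rV_lin1.
Qed.

End Realization.

(** * Connectedness of stable sets of vectors *)

Section Blocks.

Variables (F : finFieldType) (n : nat).
Notation V := 'rV[F]_n.+1.
Notation GL := {'GL_n.+1[F]}.

Lemma natural_reprE (G : {group GL}) g : natural_repr G g = GLval g.
Proof. by []. Qed.

Lemma span_ind (P : pred V) (Q : V -> Prop) :
    Q 0 -> (forall x y, Q x -> Q y -> Q (x + y)) ->
    (forall k x, Q x -> Q (k *: x)) -> (forall v, P v -> Q v) ->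
  forall x, (x <= \sum_(v | P v) <<v>>)%MS -> Q x.
Proof.
move=> Q0 QD QZ PQ x /sub_sumsmxP[c ->].
apply: (big_ind Q) => // v Pv.
have /sub_rVP[k ->]: (c v *m <<v>> <= v)%MS by rewrite -(genmxE v) submxMl.
exact/QZ/PQ.
Qed.

Variables (G : {group GL}) (S : {set V}).
Hypothesis irrG : mx_irreducible (natural_repr G).
Hypothesis GS : forall g v, g \in G -> v \in S -> v *m GLval g \in S.

Lemma irreducible_span_ind (Q : V -> Prop) :
    (exists2 v, v \in S & v != 0) ->
    Q 0 -> (forall x y, Q x -> Q y -> Q (x + y)) ->
    (forall k x, Q x -> Q (k *: x)) -> (forall v, v \in S -> Q v) ->
  forall x, Q x.
Proof.
case=> v Sv nzv Q0 QD QZ SQ x; apply: (span_ind Q0 QD QZ SQ).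
have [_ full] := (mx_irrP _).1 irrG; apply/submx_full/full.
  apply/mxmoduleP=> g Gg; rewrite natural_reprE sumsmxMr; apply/sumsmx_subP=> w Sw.
  rewrite (eqmxMr _ (genmxE w)).
  by apply: (sumsmx_sup (w *m GLval g)); rewrite ?genmxE ?GS.
apply: contraNneq nzv => sum0; rewrite -submx0 -sum0.
by apply: (sumsmx_sup v); rewrite ?genmxE.
Qed.

Variable b : {biscalar V}.
Hypothesis primG : mx_primitive (natural_repr G).
Hypothesis sGb : G \subset isom_group b.
Hypothesis b_nondeg : forall v, (forall u, b u v = 0) -> v = 0.
Hypothesis b_refl : forall u v, b u v = 0 -> b v u = 0.

Let e : rel V := [rel u v | [&& u \in S, v \in S & b u v != 0]].

Let e_sym : symmetric e.
Proof.
move=> u v; rewrite /e /= andbCA; congr [&& _, _ & ~~ _].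
by apply/eqP/eqP; apply: b_refl.
Qed.

Let W v : 'M_n.+1 := (\sum_(w | connect e v w) <<w>>)%MS.

Let connectG g u v :
  g \in G -> connect e u v -> connect e (u *m GLval g) (v *m GLval g).
Proof.
move=> Gg /connectP[p]; elim: p u => [|w p IHp] u /= => [_ -> //|].
case/andP=> /and3P[Su Sw buw] /IHp{}IHp /IHp; apply: connect_trans.
by apply: connect1; rewrite /e /= !GS // (isom_setP _ _ (subsetP sGb g Gg)).
Qed.

Let connectS u v : u \in S -> connect e u v -> v \in S.
Proof.
move=> Su /connectP[p]; elim: p u Su => [|w p IHp] u Su /= => [_ -> //|].
by case/andP=> /and3P[_ Sw _]; apply: IHp.
Qed.

Let WG g v : g \in G -> (W v *m GLval g <= W (v *m GLval g))%MS.
Proof.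
move=> Gg; rewrite sumsmxMr; apply/sumsmx_subP=> w vw.
rewrite (eqmxMr _ (genmxE w)).
by apply: (sumsmx_sup (w *m GLval g)); rewrite ?genmxE // connectG.
Qed.

Let W_orth u v x y : u \in S -> v \in S -> ~~ connect e u v ->
  (x <= W u)%MS -> (y <= W v)%MS -> b x y = 0.
Proof.
move=> Su Sv nuv xu; move: y; apply: span_ind => [|y z yx zx|k y yx|w vw].
- exact: linear0r.
- by rewrite linearDr yx zx addr0.
- by rewrite linearZr_LR /= yx mulr0.
move: x xu; apply: span_ind => [|y z yx zx|k y yx|w' vw'].
- exact: linear0l.
- by rewrite linearDl yx zx addr0.
- by rewrite linearZl_LR /= yx mulr0.
apply/eqP; apply: contraNT nuv => bw; apply: (connect_trans vw').
rewrite sym_connect_sym //; apply: (connect_trans vw).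
rewrite sym_connect_sym //; apply: connect1; rewrite /e /= bw.
by rewrite (connectS Su vw') (connectS Sv vw).
Qed.

(** A G-stable set S of vectors is connected for non-orthogonality. The spans of
    two distinct components are orthogonal, and G permutes these spans, so for a
    component span W the sum of its translates is stable, hence is V, and is
    direct because the pairing is nondegenerate. Thus V is induced from the
    stabilizer of W, which by primitivity is G; then W = V, and a vector of S
    outside the component of W would be orthogonal to V. *)
Lemma primitive_connected (C : V -> Prop) v0 :
    v0 \in S -> v0 != 0 -> C v0 ->
    (forall u v, u \in S -> v \in S -> b u v != 0 -> C u -> C v) ->
  forall v, v \in S -> v != 0 -> C v.
Proof.
move=> Sv0 nzv0 Cv0 CS v Sv nzv.
have [_ full] := (mx_irrP _).1 irrG.
have conC u : connect e v0 u -> C u.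
  move/connectP=> [p]; elim: p v0 Cv0 {Sv0 nzv0} => [|w p IHp] u0 Cu0 /= => [_ -> //|].
  by case/andP=> /and3P[Su Sw buw]; apply: IHp; apply: CS buw Cu0.
have W_nz u : u != 0 -> W u != 0.
  apply: contraNneq => Wu0; rewrite -submx0 -Wu0.
  by apply: (sumsmx_sup u); rewrite ?genmxE ?connect0.
pose H := rstabs_group (natural_repr G) (W v0).
have sHG : H \subset G by apply/subsetP=> g; rewrite inE => /andP[].
have HP g : g \in G -> (W v0 *m GLval g <= W v0)%MS -> g \in H.
  by move=> Gg Wg; rewrite inE Gg.
have [sGH | nsGH] := boolP (G \subset H).
  apply: conC; apply: contraNT nzv => nv0v; apply/eqP/b_nondeg => u.
  apply: (W_orth Sv0 Sv nv0v); first by rewrite submx_full // full // W_nz.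
  by apply: (sumsmx_sup v); rewrite ?genmxE ?connect0.
case: primG; exists H; first by rewrite properE sHG.
(* The translate of W v0 by r A depends only on the coset A of its stabilizer H. *)
pose r (A : {set GL}) : GL := repr A.
have rP A : A \in rcosets H G -> r A \in G /\ A = (H :* r A)%g.
  case/rcosetsP=> a Ga ->; rewrite /r; have rHa := mem_repr_rcoset H a.
  split; last by rewrite rcoset_repr.
  by case/rcosetP: rHa => h /(subsetP sHG) Gh ->; rewrite groupM.
pose sumW := (\sum_(A in rcosets H G) (W v0 *m natural_repr G (r A)))%MS.
have WsumW g : g \in G -> (W v0 *m GLval g <= sumW)%MS.
  move=> Gg; have HGg : (H :* g)%g \in rcosets H G by apply/rcosetsP; exists g.
  apply: (sumsmx_sup (H :* g)%g) => //; rewrite natural_reprE.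
  have /rcosetP[h Hh def_r] := mem_repr_rcoset H g; rewrite /r.
  have -> : GLval g = GLval h^-1%g *m GLval (repr (H :* g)%g).
    by rewrite -GL_MxE def_r mulKg.
  rewrite mulmxA submxMr //; have: h^-1%g \in H by rewrite groupV.
  by rewrite inE => /andP[].
have full_sumW : row_full sumW.
  apply: full; last first.
    apply: contraNneq (W_nz _ nzv0) => sum0; rewrite -submx0 -sum0.
    by have := WsumW _ (group1 G); rewrite GL_1E mulmx1.
  apply/mxmoduleP=> g Gg; rewrite sumsmxMr; apply/sumsmx_subP=> A HA.
  by have := WsumW _ (groupM (rP A HA).1 Gg); rewrite GL_MxE mulmxA.
exists (W v0); split=> [h|/=|].
- by rewrite inE => /andP[_].
- apply/mxdirect_sumsP=> A HA; apply/eqP/rowV0P=> x.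
  rewrite sub_capmx => /andP[xA xB]; apply: b_nondeg => y.
  have [GA defA] := rP A HA.
  have orthAB B : B \in rcosets H G -> B != A -> forall z t,
    (z <= W v0 *m GLval (r A))%MS -> (t <= W v0 *m GLval (r B))%MS -> b z t = 0.
    move=> HB neqBA z t zA tB; have [GB defB] := rP B HB.
    apply: W_orth (submx_trans zA (WG _ GA)) (submx_trans tB (WG _ GB)); rewrite ?GS //.
    apply: contraNN neqBA => conAB.
    suff: r A \in (H :* r B)%g by move/rcoset_eqP; rewrite -defA -defB => ->.
    rewrite mem_rcoset; apply: HP; first by rewrite groupM ?groupVr.
    rewrite GL_MxE mulmxA.
    apply: submx_trans (submxMr _ (WG _ GA)) _.
    have -> : W (v0 *m GLval (r A)) = W (v0 *m GLval (r B)).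
      by rewrite /W; apply: eq_bigl; apply: same_connect (sym_connect_sym e_sym) _ _ conAB.
    by have := WG (v0 *m GLval (r B)) (groupVr GB); rewrite mulGLK.
  have orth_others z t : (z <= \sum_(B | (B \in rcosets H G) && (B != A))
      (W v0 *m natural_repr G (r B)))%MS -> (t <= W v0 *m GLval (r A))%MS -> b z t = 0.
    case/sub_sumsmxP=> c -> tA; rewrite linear_sumlz big1 // => B /andP[HB neqBA].
    by apply/b_refl/(orthAB B); rewrite ?submxMl.
  have := submx_full y full_sumW; rewrite /sumW (bigD1 A) //=.
  case/sub_addsmxP=> -[c1 c2] /= ->; rewrite linearDl.
  rewrite [X in X + _]b_refl ?add0r; last by apply: (orth_others _ _ xB); apply: submxMl.
  by apply: orth_others xA; apply: submxMl.
- by rewrite submx1 sub1mx; apply: full_sumW.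
Qed.

End Blocks.

(** * Pairings *)

Section Bilinear.

Variables (F : finFieldType) (n : nat) (b : {biscalar 'rV[F]_n.+1}).

Lemma biscalarE :
  ((forall u v w, b (u + v) w = b u w + b v w) *
   (forall u v, b (- u) v = - b u v) *
   (forall k u v, b (k *: u) v = k * b u v) *
   (forall v, b 0 v = 0)) *
  ((forall u v w, b u (v + w) = b u v + b u w) *
   (forall u v, b u (- v) = - b u v) *
   (forall k u v, b u (k *: v) = k * b u v) *
   (forall u, b u 0 = 0)).
Proof.
do !split=> *; rewrite ?linearDl ?linearDr ?linearNl ?linearNr //;
  by rewrite ?linearZl_LR ?linearZr_LR ?linear0l ?linear0r ?linearNl ?linearNr.
Qed.

Lemma nonorth_exists v :
  (forall w, (forall u, b u w = 0) -> w = 0) -> v != 0 -> exists u, b u v != 0.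
Proof.
move=> b_nondeg nzv; apply/existsP; apply: contraNT nzv.
rewrite negb_exists => /forallP bv0; apply/eqP/b_nondeg => u; apply/eqP.
by have := bv0 u; rewrite negbK.
Qed.

End Bilinear.

(** * Subgroups of index at most two *)

Section InvolutionCosets.

Variables (gT : finGroupType) (N : {group gT}) (r : gT).
Hypotheses (rK : (r * r = 1)%g) (nNr : r \in 'N(N)%g).

Let rV : (r^-1 = r)%g.
Proof. by apply: (mulgI r); rewrite mulgV rK. Qed.

Let Nr h : h \in N -> (r * h * r)%g \in N.
Proof. by move=> Nh; have := memJ_norm h nNr; rewrite conjgE rV mulgA Nh => ->. Qed.

Lemma involution_conj g h : g \in N -> (h ^ g * r)%g \in N -> (h * r)%g \in N.
Proof.
move=> Ng Nhr.
have -> : (h * r)%g = (g * (h ^ g * r) * (r * g^-1 * r))%g.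
  by rewrite conjgE -!mulgA (mulgA r r) rK mul1g mulKVg mulKVg.
by apply: groupM (Nr (groupVr Ng)); apply: groupM.
Qed.

Lemma involution_cosets g h :
    h \in N \/ (h * r)%g \in N -> (g * h)%g \in N \/ (g * h * r)%g \in N ->
  g \in N \/ (g * r)%g \in N.
Proof.
case=> Nh [Ngh|Ngh]; [left|right|right|left].
- by rewrite -(mulgK h g); apply: groupM Ngh (groupVr Nh).
- have -> : (g * r)%g = (g * h * r * (r * h^-1 * r))%g.
    by rewrite -!mulgA (mulgA r r) rK mul1g mulKVg.
  by apply: groupM Ngh (Nr (groupVr Nh)).
- have -> : (g * r)%g = (g * h * (r * (h * r)^-1 * r))%g.
    by rewrite invMg rV -!mulgA (mulgA r r) rK mul1g mulKVg.
  by apply: groupM Ngh (Nr (groupVr Nh)).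
- by rewrite -(mulgK (h * r)%g g) mulgA; apply: groupM Ngh (groupVr Nh).
Qed.

End InvolutionCosets.

Section IndexTwo.

Variables (F : finFieldType) (gT : finGroupType) (O G : {group gT}) (X : {set gT}).
Variables (chi : gT -> F) (r : gT).
Hypothesis F2 : 2 != 0 :> F.
Hypothesis chiM : {in O &, {morph chi : g h / (g * h)%g >-> g * h}}.
Hypotheses (sXG : X \subset G) (sGO : G \subset O) (Or : r \in O).
Hypothesis chiX : {in X, forall g, chi g = 1}.
Hypothesis chir : chi r = -1.
Hypothesis cosets : forall g, g \in O -> g \in <<X>>%g \/ (g * r)%g \in <<X>>%g.

(** <<X>> lies in the kernel of chi, while r does not; as <<X>> and its coset by r
    cover O, <<X>> is this kernel, and a group between <<X>> and O contains r
    or is equal to <<X>>. *)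
Lemma index_two_overgroup :
  G = O :> {set gT} \/ G = [set g in O | chi g == 1] :> {set gT}.
Proof.
pose K := [set g in O | chi g == 1].
have chi1 : chi 1%g = 1.
  have := chiM Or (group1 O); rewrite mulg1 chir => /eqP.
  by rewrite mulN1r eqr_opp => /eqP.
have Kgroup : group_set K.
  apply/group_setP; split=> [|g h]; first by rewrite inE group1 chi1 eqxx.
  rewrite !inE => /andP[Og /eqP cg] /andP[Oh /eqP ch].
  by rewrite groupM //= chiM // cg ch mulr1.
have sNK : <<X>>%g \subset Group Kgroup.
  rewrite gen_subG; apply/subsetP=> g Xg.
  by rewrite inE chiX // eqxx (subsetP sGO) // (subsetP sXG).
have sNG : <<X>>%g \subset G by rewrite gen_subG.
have [Gr | nGr] := boolP (r \in G).
  left; apply/eqP; rewrite eqEsubset sGO; apply/subsetP=> g /cosets[]/(subsetP sNG) //.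
  by rewrite groupMr.
right; apply/setP=> g; rewrite inE; apply/idP/andP=> [Gg | [Og /eqP cg]].
  have Og := subsetP sGO g Gg; split=> //; case/cosets: Og => Ng.
    by have := subsetP sNK g Ng; rewrite inE => /andP[].
  by case/negP: nGr; rewrite -(groupMl r Gg); apply: (subsetP sNG).
case/cosets: (Og) => [/(subsetP sNG) // | /(subsetP sNK)].
rewrite inE chiM // cg chir mul1r => /andP[_].
by rewrite eq_sym -addr_eq0 (negPf F2).
Qed.

End IndexTwo.

(** * Generation by descent on the moved vectors *)

Section Descent.

Variables (F : finFieldType) (n : nat).
Notation V := 'rV[F]_n.+1.
Notation GL := {'GL_n.+1[F]}.

Definition moved (g : GL) : {set V} := [set y : V | y *m GLval g != y].

Lemma moved_proper (g h : GL) (x : V) :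
    (forall y : V, y *m GLval g = y -> y *m GLval h = y) ->
    x *m GLval g != x -> x *m GLval g *m GLval h = x ->
  (#|moved (g * h)%g| < #|moved g|)%N.
Proof.
move=> fix_h xg xgh; apply/proper_card/properP; split.
  apply/subsetP=> y; rewrite !inE mulGL; apply: contraNneq => yg.
  by rewrite yg fix_h.
by exists x; rewrite !inE ?mulGL ?xgh ?eqxx.
Qed.

(** To show that a class of isometries generates, it is enough to multiply any
    nontrivial element by members of the class so that it moves fewer vectors. *)
Lemma moved_ind (O : {group GL}) (Q : GL -> Prop) :
    Q 1%g ->
    (forall g (x : V), g \in O -> x *m GLval g != x ->
      exists h, [/\ h \in O, (#|moved (g * h)%g| < #|moved g|)%N
                   & Q (g * h)%g -> Q g]) ->
  forall g, g \in O -> Q g.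
Proof.
move=> Q1 QS g; have [m] := ubnP #|moved g|; elim: m g => // m IHm g.
move=> /ltnSE-le_g Og; case: (set_0Vmem (moved g)) => [g0 | [x]].
  suff ->: g = 1%g by [].
  apply: GL_ext => x; rewrite mulGL1; apply/eqP.
  by have := in_set0 x; rewrite -g0 inE => /negbFE.
rewrite inE => xg; have [h [Oh gh_lt]] := QS g x Og xg; apply.
by apply: IHm; rewrite ?groupM // (leq_trans gh_lt).
Qed.

Lemma drop1_rank (g : GL) :
  drop_of g = 1%N -> exists2 v, v != 0 & forall x : V, exists k, x *m GLval g = x + k *: v.
Proof.
rewrite /drop_of /eigenspace mxrank_ker => drop1.
have rk1 : \rank (GLval g - 1%:M) = 1%N.
  suff arith m r : (m - (m - r) = 1 -> r <= m -> r = 1)%N.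
    exact: arith drop1 (rank_leq_row _).
  by lia.
have /rowV0Pn[v v_im nzv] : GLval g - 1%:M != 0 by rewrite -mxrank_eq0 rk1.
have im_v : (GLval g - 1%:M <= v)%MS.
  by rewrite -(mxrank_leqif_sup v_im) rk1 rank_rV nzv.
exists v => // x; have /sub_rVP[k xk] := submx_trans (submxMl x _) im_v.
by exists k; rewrite -xk mulmxBr mulmx1 addrC subrK.
Qed.

Lemma drop1_moves (g : GL) : drop_of g = 1%N -> ~ (forall x : V, x *m GLval g = x).
Proof.
rewrite /drop_of /eigenspace mxrank_ker => drop1 g1.
suff g0 : GLval g - 1%:M = 0 by move: drop1; rewrite g0 mxrank0 subn0 subnn.
by apply/row_matrixP=> i; rewrite !rowE mulmxBr g1 mulmx1 subrr mulmx0.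
Qed.

End Descent.

(** * Groups with a transvection *)

Section Symplectic.

Variables (F : finFieldType) (n : nat) (b : {biscalar 'rV[F]_n.+1}).
Notation V := 'rV[F]_n.+1.
Notation GL := {'GL_n.+1[F]}.
Implicit Types (u v w x y : V) (g h : GL).

Hypothesis F2 : 2 != 0 :> F.
(* F is a prime field: a subgroup closed under sums is closed under scaling. *)
Hypothesis primeF : forall k : F, exists m : nat, k = m%:R.
Hypothesis b_nondeg : forall v, (forall u, b u v = 0) -> v = 0.
Hypothesis b_alt : alternating_pairing b.

Definition transvection v (c : F) x : V := x + (c * b x v) *: v.

Lemma alternating_anti u v : b u v = - b v u.
Proof.
have := b_alt (u + v); rewrite !biscalarE !b_alt add0r addr0.
by move=> /addr0_eq/esym ->; rewrite opprK.
Qed.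

Lemma alternating_refl u v : b u v = 0 -> b v u = 0.
Proof. by rewrite alternating_anti => /eqP; rewrite oppr_eq0 => /eqP. Qed.

Lemma transvectionD v c d x :
  transvection v d (transvection v c x) = transvection v (c + d) x.
Proof.
rewrite /transvection !biscalarE b_alt mulr0 addr0.
by apply/rowP=> i; rewrite !mxE; ring.
Qed.

Lemma isom_transvection g :
    g \in isom_group b -> drop_of g = 1%N ->
  exists v c, [/\ v != 0, c != 0 & forall x, x *m GLval g = transvection v c x].
Proof.
move=> /isom_setP bg drop1; have [v nzv gE] := drop1_rank drop1.
have [y byv] := nonorth_exists b_nondeg nzv.
have [ky yE] := gE y; exists v, (ky / b y v).
have gE' x : x *m GLval g = transvection v (ky / b y v) x.
  have [k xE] := gE x; rewrite xE /transvection; congr (_ + _ *: v).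
  have := bg x y; rewrite xE yE !biscalarE b_alt (alternating_anti v y) => eq_b.
  apply: (mulIf byv); rewrite mulrAC divfK //.
  by apply/eqP; rewrite -subr_eq0 -oppr_eq0; apply/eqP; move: eq_b => /eqP;
     rewrite -subr_eq0 => /eqP <-; ring.
split=> //; apply/eqP=> ky0; apply: (drop1_moves drop1) => x.
by rewrite gE' ky0 /transvection mul0r scale0r addr0.
Qed.

Section Generation.

Variable G : {group GL}.
Hypothesis all_transv : forall v c, realized G (transvection v c).

Lemma transvection_isom g v c :
  (forall x, x *m GLval g = transvection v c x) -> g \in isom_group b.
Proof.
move=> gE; apply/isom_setP=> x y; rewrite !gE !biscalarE b_alt.
by rewrite (alternating_anti v y); ring.
Qed.

(** The transvection with root v = x g - x sends x g back to x once it is suitably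
    scaled, and fixes all the fixed vectors of g, which are orthogonal to v. *)
Lemma transvection_straighten g x :
    g \in isom_group b -> b x (x *m GLval g) != 0 ->
  exists t : GL, [/\ t \in G, t \in isom_group b,
    forall y, y *m GLval g = y -> y *m GLval t = y & x *m GLval g *m GLval t = x].
Proof.
move=> /isom_setP bg bx; pose v := x *m GLval g - x.
have /realizedP[t Gt tE] := all_transv v (b (x *m GLval g) x)^-1.
exists t; split=> // [|y yg|]; first exact: transvection_isom tE.
  have byv : b y v = 0 by rewrite /v !biscalarE -{1}yg bg subrr.
  by rewrite tE /transvection byv mulr0 scale0r addr0.
rewrite tE /transvection /v !biscalarE b_alt add0r mulrN mulVf.
  by rewrite scaleN1r opprB addrC subrK.
by rewrite alternating_anti oppr_eq0.
Qed.

(** When x and x g are always orthogonal, [transvection_straighten] does not apply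
    to g, but it does after multiplying g by the transvection with root
    v = x g - x: this does not move the fixed vectors of g either, and produces
    the pairing - (b y v) ^ 2 of y with its image. *)
Lemma transvections_generate g : g \in isom_group b -> g \in G.
Proof.
move: g; apply: (@moved_ind _ _ _ (fun g => g \in G)) => [|g x Og xg].
  exact: group1.
suff [h [Gh Oh fix_h [y yg ygh]]] : exists h : GL, [/\ h \in G, h \in isom_group b,
    forall y : V, y *m GLval g = y -> y *m GLval h = y
    & exists2 y : V, y *m GLval g != y & y *m GLval g *m GLval h = y].
  exists h; split=> [//||]; first exact: moved_proper yg ygh.
  by rewrite groupMr.
have /isom_setP bg := Og.
have [/existsP[y bygy] | ] := boolP [exists y, b y (y *m GLval g) != 0].
  have [h [Gh Oh fix_h ygh]] := transvection_straighten Og bygy.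
  by exists h; split=> //; exists y => //; apply: contraNneq bygy => ->; rewrite b_alt.
rewrite negb_exists => /forallP b0.
have{}b0 y : b y (y *m GLval g) = 0 by apply/eqP; have := b0 y; rewrite negbK.
have [v Dv] : exists v, v = x *m GLval g - x by exists (x *m GLval g - x).
have nzv : v != 0 by rewrite Dv subr_eq0.
have [y byv] := nonorth_exists b_nondeg nzv.
have /realizedP[h Gh hE] := all_transv v 1; have Oh := transvection_isom hE.
have fix_h (z : V) : z *m GLval g = z -> z *m GLval h = z.
  move=> zg; have bzv : b z v = 0 by rewrite Dv !biscalarE -{1}zg bg subrr.
  by rewrite hE /transvection bzv mulr0 scale0r addr0.
have bygv : b (y *m GLval g) v = - b y v.
  have := b0 (x + y); rewrite mulmxDl !biscalarE !b0 add0r addr0 => eq_b.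
  rewrite Dv !biscalarE bg (alternating_anti (y *m GLval g) x).
  by rewrite -(addr0_eq eq_b); ring.
have Ogh : (g * h)%g \in isom_group b by rewrite groupM.
have byghy : b y (y *m GLval (g * h)%g) != 0.
  rewrite mulGL hE /transvection !biscalarE b0 bygv add0r mul1r mulNr oppr_eq0.
  by rewrite mulf_neq0.
have [k [Gk Ok fix_k yghk]] := transvection_straighten Ogh byghy.
exists (h * k)%g; split; rewrite ?groupM //.
  by move=> z zg; rewrite mulGL fix_h // fix_k // mulGL zg fix_h.
exists y; last by rewrite -!mulGL mulgA !mulGL -!mulGL mulGL.
apply: contraNneq byv => yg; have := bygv; rewrite yg => /eqP.
by rewrite -addr_eq0 -mulr2n -mulr_natl mulf_eq0 (negPf F2).
Qed.

End Generation.

Section Transvections.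

Variable G : {group GL}.
Hypothesis irrG : mx_irreducible (natural_repr G).
Hypothesis primG : mx_primitive (natural_repr G).
Hypothesis sGb : G \subset isom_group b.

Let L : {set V} := [set v : V | [forall c, realized G (transvection v c)]].

Let LP v : reflect (forall c, realized G (transvection v c)) (v \in L).
Proof. by rewrite inE; apply: forallP. Qed.

Let LG g v : g \in G -> v \in L -> v *m GLval g \in L.
Proof.
move=> Gg /LP Lv; apply/LP=> c; apply: realizedJ (Lv c).
  exact: (subsetP (normG G) g Gg).
move=> x; rewrite /transvection (isom_setP _ _ (subsetP sGb g Gg)).
by rewrite mulmxDl -scalemxAl.
Qed.

Let LT u v c : u \in L -> v \in L -> u + (c * b u v) *: v \in L.
Proof. by move=> Lu /LP/(_ c)/realizedP[g Gg gE]; rewrite -[_ + _]gE LG. Qed.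

Let LZ k v : v \in L -> k *: v \in L.
Proof.
move=> /LP Lv; apply/LP=> c; apply: eq_realized (Lv (c * k ^+ 2)) => x.
by rewrite /transvection !biscalarE scalerA; congr (_ + _ *: _); ring.
Qed.

Let L_line u v c : u \in L -> v \in L -> b u v != 0 -> u + c *: v \in L.
Proof. by move=> Lu Lv buv; have := LT (c / b u v) Lu Lv; rewrite divfK. Qed.

Let L_add u v : u \in L -> v \in L -> b u v != 0 -> u + v \in L.
Proof. by move=> Lu Lv buv; have := L_line 1 Lu Lv buv; rewrite scale1r. Qed.

Lemma transvection_powers v c d :
  c != 0 -> realized G (transvection v c) -> realized G (transvection v d).
Proof.
move=> nzc Gv; have [m Dm] := primeF (d / c).
have -> : d = m%:R * c by rewrite -Dm divfK.
elim: m {Dm} => [|m IHm].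
  by apply: eq_realized (realized_id G) => x; rewrite /transvection !mul0r scale0r addr0.
apply: eq_realized (realized_comp IHm Gv) => x.
by rewrite /= transvectionD -natr1 mulrDl mul1r.
Qed.

Hypothesis G_transv : exists2 v, v != 0 & v \in L.

Let L_nonorth x : x != 0 -> exists2 u, u \in L & b u x != 0.
Proof.
move=> nzx; have [/exists_inP[]|] := boolP [exists u in L, b u x != 0].
  by move=> u; exists u.
rewrite negb_exists_in => /forall_inP b0; case/eqP: nzx; apply: b_nondeg.
have [v nzv Lv] := G_transv.
apply: (irreducible_span_ind irrG LG) => [|||k u|u /b0].
- by exists v.
- by rewrite !biscalarE.
- by move=> u w; rewrite !biscalarE => -> ->; rewrite addr0.
- by rewrite !biscalarE => ->; rewrite mulr0.
- by rewrite negbK => /eqP.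
Qed.

(** Paths in the non-orthogonality graph shorten to length two: if v - u - w - w'
    is a path without shortcut, then u + w is again in L, and is not orthogonal to
    either end. *)
Let L_common v w : v \in L -> w \in L -> v != 0 -> w != 0 ->
  exists u, [/\ u \in L, b u v != 0 & b u w != 0].
Proof.
move=> Lv Lw nzv nzw.
apply: (primitive_connected irrG LG primG sGb b_nondeg alternating_refl
          (C := fun w => exists u, [/\ u \in L, b u v != 0 & b u w != 0]) Lv) => //.
  by have [u Lu buv] := L_nonorth nzv; exists u.
move=> {nzw} {Lw}w w' Lw Lw' bww' [u [Lu buv buw]].
have [buw' | buw'] := eqVneq (b u w') 0; last by exists u.
have [bwv | bwv] := eqVneq (b w v) 0; last by exists w.
exists (u + w); rewrite !biscalarE bwv buw' addr0 add0r; split=> //.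
exact: L_add.
Qed.

(** Sums of nonorthogonal members of L are in L, and v + w is reached from u by
    adding v, then w, then - u. *)
Let L_add_orth u v w : u \in L -> v \in L -> w \in L ->
    b v w = 0 -> b u v != 0 -> b u w != 0 -> b u (v + w) != 0 -> v + w \in L.
Proof.
move=> Lu Lv Lw bvw buv buw buvw.
have -> : v + w = (u + v + w) + (-1) *: u by apply/rowP=> i; rewrite !mxE; ring.
apply: L_line => //; last first.
  move: buvw; rewrite !biscalarE b_alt add0r => buvw.
  by rewrite (alternating_anti v) (alternating_anti w) -opprD oppr_eq0.
by apply: L_add; rewrite ?L_add // !biscalarE bvw addr0.
Qed.

(** If v + w is orthogonal to the common neighbour u of v and w, then u is
    replaced by x, or by some x + c u' that is not orthogonal to v, w or v + w. *)
Let L_addW u x v w : u \in L -> x \in L -> v \in L -> w \in L ->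
    b v w = 0 -> b u v != 0 -> b u w != 0 -> b x v != 0 -> b x (v + w) != 0 ->
  v + w \in L.
Proof.
move=> Lu Lx Lv Lw bvw buv buw bxv bxvw.
have [bxw|] := eqVneq (b x w) 0; last by move=> bxw; apply: (L_add_orth Lx).
have [buvw|] := eqVneq (b u (v + w)) 0; last by apply: L_add_orth.
have [u' [Lu' bxu' bu'v bu'w bu'vw]] : exists u', [/\ u' \in L, b x u' != 0,
     b u' v = b u v, b u' w = b u w & b u' (v + w) = b u (v + w)].
  (* Adding v to u changes its pairing with x, but not with v, w or v + w. *)
  have [bxu|] := eqVneq (b x u) 0; last by exists u.
  exists (u + v); rewrite !biscalarE bxu b_alt bvw !addr0 add0r; split=> //.
  exact: L_add.
have [c nzc bc] : exists2 c, c != 0 & b x v + c * b u v != 0.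
  have [b1|] := eqVneq (b x v + 1 * b u v) 0; last by exists 1; rewrite ?oner_eq0.
  exists (-1); first by rewrite oppr_eq0 oner_eq0.
  have -> : b x v + -1 * b u v = 2 * b x v - (b x v + 1 * b u v) by ring.
  by rewrite b1 subr0 mulf_neq0.
apply: (L_add_orth (L_line c Lx Lu' bxu')) => //.
- by rewrite !biscalarE bu'v.
- by rewrite !biscalarE bu'w bxw add0r mulf_neq0.
- by rewrite linearDl linearZl_LR /= bu'vw buvw mulr0 addr0.
Qed.

(** The roots of the transvections of G form, with 0, a subspace: it is stable
    under G, so it is the whole space. *)
Lemma primitive_transvections v c : realized G (transvection v c).
Proof.
suff: v \in L by move/LP.
have L0 : 0 \in L.
  apply/LP=> d; apply: eq_realized (realized_id G) => x.
  by rewrite /transvection scaler0 addr0.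
have [z nzz Lz] := G_transv.
apply: (irreducible_span_ind irrG LG (Q := fun v => v \in L)).
- by exists z.
- exact: L0.
- move=> x y Lx Ly.
  have [->|nzx] := eqVneq x 0; first by rewrite add0r.
  have [->|nzy] := eqVneq y 0; first by rewrite addr0.
  have [bxy|bxy] := eqVneq (b x y) 0; last exact: L_add.
  have [->//|nzxy] := eqVneq (x + y) 0.
  have [u [Lu bux buy]] := L_common Lx Ly nzx nzy.
  have [t Lt btxy] := L_nonorth nzxy.
  have [btx | btx] := eqVneq (b t x) 0; last by apply: (L_addW Lu Lt).
  rewrite addrC; apply: (L_addW Lu Lt) => //; rewrite ?(addrC y) //.
    by rewrite alternating_refl.
  by move: btxy; rewrite !biscalarE btx add0r.
- exact: LZ.
- by [].
Qed.

End Transvections.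

Lemma primitive_transvection_group (G : {group GL}) :
    mx_irreducible (natural_repr G) -> mx_primitive (natural_repr G) ->
    G \subset isom_group b -> (exists2 g, g \in G & drop_of g = 1%N) ->
  G = isom_group b :> {set GL}.
Proof.
move=> irrG primG sGb [g Gg drop1]; apply/eqP; rewrite eqEsubset sGb /=.
have [v [c [nzv nzc gE]]] := isom_transvection (subsetP sGb g Gg) drop1.
apply/subsetP=> h; apply: transvections_generate; apply: primitive_transvections => //.
exists v => //; rewrite inE; apply/forallP=> d.
by apply: transvection_powers nzc _; apply/realizedP; exists g.
Qed.

End Symplectic.

(** * Reflections and Eichler transformations *)

Section Orthogonal.

Variables (F : finFieldType) (n : nat) (b : {biscalar 'rV[F]_n.+1}).
Notation V := 'rV[F]_n.+1.
Notation GL := {'GL_n.+1[F]}.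
Implicit Types (e f u v w x y z : V) (g h : GL) (k : F).

Hypothesis F2 : 2 != 0 :> F.
Hypothesis b_sym : symmetric_pairing b.

Ltac vector_ring := by apply/rowP=> ?; rewrite !mxE; ring.

Ltac vector_field :=
  apply/rowP=> ?; rewrite !mxE; field; do ?[apply/andP; split]; by [].

Definition reflection v x : V := x - (2 * b x v / b v v) *: v.

(** The Eichler (or Siegel) transformation of an isotropic vector e and a vector
    y orthogonal to e: it fixes e and maps z to z - b z y e on the orthogonal of
    e, which determines it as an isometry. *)
Definition eichler e y x : V := x + b x e *: y - (b x y + b y y / 2 * b x e) *: e.

Lemma reflection_linear v : linear (reflection v).
Proof.
move=> k x y; rewrite /reflection !biscalarE.
vector_ring.
Qed.

Lemma reflection_pairing v x y : b v v != 0 ->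
  b (reflection v x) y = b x (reflection v y).
Proof.
by move=> nzv; rewrite /reflection !biscalarE (b_sym v y); field.
Qed.

Lemma reflectionK v : b v v != 0 -> involutive (reflection v).
Proof.
move=> nzv x; rewrite /reflection !biscalarE.
vector_field.
Qed.

Lemma reflection_isom v x y : b v v != 0 ->
  b (reflection v x) (reflection v y) = b x y.
Proof. by move=> nzv; rewrite reflection_pairing // reflectionK. Qed.

Lemma reflectionZ k v x : k != 0 -> reflection (k *: v) x = reflection v x.
Proof.
move=> nzk; rewrite /reflection !biscalarE scalerA; congr (_ - _ *: _).
have [->|nzv] := eqVneq (b v v) 0; first by rewrite !mulr0 !invr0 !mulr0 mul0r.
by field; do ?[apply/andP; split].
Qed.

Lemma eichlerD e y z x : b e e = 0 -> b e y = 0 -> b e z = 0 ->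
  eichler e z (eichler e y x) = eichler e (y + z) x.
Proof.
move=> ee ey ez; have ye : b y e = 0 by rewrite b_sym.
rewrite /eichler !biscalarE ee ez ye (b_sym z y).
vector_field.
Qed.

Lemma eichlerZ e y k x : eichler (k *: e) y x = eichler e (k *: y) x.
Proof.
rewrite /eichler !biscalarE.
vector_field.
Qed.

(** This identity turns reflections into Eichler transformations: v and v + k e
    span a degenerate plane, where the product of the reflections is unipotent. *)
Lemma reflection_pair_eichler e v k x :
    b v v != 0 -> b e e = 0 -> b e v = 0 ->
  reflection (v + k *: e) (reflection v x) =
    eichler e (- (2 * k / b v v) *: v) x.
Proof.
move=> nzv ee ev; have ve : b v e = 0 by rewrite b_sym.
rewrite /reflection /eichler !biscalarE ee ev ve.
vector_field.
Qed.

Section ReflectionGroup.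

Variables (N : {group GL}) (a : F).
Hypothesis sNb : N \subset isom_group b.
Hypothesis nza : a != 0.
(* F is a prime field, so that siegelZ follows from siegelD. *)
Hypothesis primeF : forall k : F, exists m : nat, k = m%:R.

(** The roots are normalized to have norm a, so that all of them belong to one
    class modulo squares. *)
Definition is_root v := (b v v == a) && realized N (reflection v).

(** For e fixed, the y such that siegel e y form a subspace, by the additivity
    of Eichler transformations in y; the strategy is to enlarge this subspace
    until it is the whole orthogonal of e. *)
Definition siegel e y := [&& b e e == 0, b e y == 0 & realized N (eichler e y)].

Lemma root_norm v : is_root v -> b v v = a.
Proof. by case/andP=> /eqP. Qed.

Lemma root_neq0 v : is_root v -> v != 0.
Proof. by move/root_norm=> vv; apply: contraNneq nza => v0; rewrite -vv v0 biscalarE. Qed.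

Lemma root_normalizer g v :
  g \in isom_group b -> g \in 'N(N)%g -> is_root v -> is_root (v *m GLval g).
Proof.
move=> /isom_setP bg nNg /andP[vv rv]; rewrite /is_root bg vv /=.
by apply: realizedJ nNg _ rv => x; rewrite /reflection !bg mulmxBl -scalemxAl.
Qed.

Lemma siegel_normalizer g e y :
    g \in isom_group b -> g \in 'N(N)%g -> siegel e y ->
  siegel (e *m GLval g) (y *m GLval g).
Proof.
move=> /isom_setP bg nNg /and3P[ee ey se]; rewrite /siegel !bg ee ey /=.
apply: realizedJ nNg _ se => x.
by rewrite /eichler !bg mulmxBl mulmxDl -!scalemxAl.
Qed.

Lemma realized_root phi v : realized N phi -> is_root v -> is_root (phi v).
Proof.
case/realizedP=> g Ng <-; apply: root_normalizer; first exact: (subsetP sNb).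
exact: (subsetP (normG N)).
Qed.

Lemma realized_siegel phi e y :
  realized N phi -> siegel e y -> siegel (phi e) (phi y).
Proof.
case/realizedP=> g Ng gE; rewrite -!gE.
by apply: siegel_normalizer; [apply: (subsetP sNb) | apply: (subsetP (normG N))].
Qed.

Lemma is_root_act g v : g \in N -> is_root (v *m GLval g) -> is_root v.
Proof. by move=> /realized_inv rg /(realized_root rg); rewrite mulGLK. Qed.

Lemma siegel_act g e y :
  g \in N -> siegel (e *m GLval g) (y *m GLval g) -> siegel e y.
Proof. by move=> /realized_inv rg /(realized_siegel rg); rewrite !mulGLK. Qed.

Lemma root_reflection u v : is_root u -> is_root v -> is_root (reflection u v).
Proof. by case/andP=> _; apply: realized_root. Qed.

Lemma siegel_reflection u e y :
  is_root u -> siegel e y -> siegel (reflection u e) (reflection u y).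
Proof. by case/andP=> _; apply: realized_siegel. Qed.

Lemma root_eichler e y v : siegel e y -> is_root v -> is_root (eichler e y v).
Proof. by case/and3P=> _ _; apply: realized_root. Qed.

Lemma siegelD e y z : siegel e y -> siegel e z -> siegel e (y + z).
Proof.
case/and3P=> ee /eqP ey sy /and3P[_ /eqP ez sz].
rewrite /siegel ee biscalarE ey ez addr0 eqxx.
by apply: eq_realized (realized_comp sy sz) => x; rewrite /= eichlerD // (eqP ee).
Qed.

Lemma siegel0 e : b e e = 0 -> siegel e 0.
Proof.
move=> ee; rewrite /siegel ee biscalarE eqxx.
apply: eq_realized (realized_id N) => x; rewrite /eichler !biscalarE.
vector_field.
Qed.

Lemma siegel_self e : b e e = 0 -> siegel e e.
Proof.
move=> ee; rewrite /siegel ee eqxx.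
apply: eq_realized (realized_id N) => x; rewrite /eichler ee.
vector_field.
Qed.

Lemma siegelZ e y k : siegel e y -> siegel e (k *: y).
Proof.
move=> sy; have [m ->] := primeF k; elim: m => [|m IHm].
  by rewrite scale0r siegel0 //; case/and3P: sy => /eqP.
by rewrite -natr1 scalerDl scale1r siegelD.
Qed.

Lemma siegelZr e y k : k != 0 -> siegel e (k *: y) -> siegel e y.
Proof. by move=> nzk /(siegelZ k^-1); rewrite scalerA mulVf ?scale1r. Qed.

Lemma siegelZl e y k : siegel e y -> siegel (k *: e) y.
Proof.
move=> sy; have /and3P[ee ey _] := sy; have /and3P[_ _ sky] := siegelZ k sy.
rewrite /siegel !biscalarE (eqP ee) (eqP ey) !mulr0 eqxx /=.
by apply: eq_realized sky => x; rewrite eichlerZ.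
Qed.

Lemma siegelB e y z : siegel e y -> siegel e z -> siegel e (y - z).
Proof. by move=> sy sz; rewrite -scaleN1r siegelD ?siegelZ. Qed.

Lemma siegel_of_roots e v k :
  b e e = 0 -> b e v = 0 -> k != 0 -> is_root v -> is_root (v + k *: e) -> siegel e v.
Proof.
move=> ee ev nzk rv rvk; have vv := root_norm rv.
have nz : - (2 * k / a) != 0 by rewrite oppr_eq0 !mulf_neq0 ?invr_eq0.
apply: (siegelZr nz); rewrite /siegel ee biscalarE ev mulr0 eqxx /=.
case/andP: rv => _ rv; case/andP: rvk => _ rvk.
apply: eq_realized (realized_comp rv rvk) => x.
by rewrite /= reflection_pair_eichler ?vv.
Qed.

Lemma root_shift e v k : siegel e v -> is_root v -> is_root (v + k *: e).
Proof.
move=> se rv; have := root_eichler (siegelZ (- k / a) se) rv.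
have /and3P[/eqP ee /eqP ev _] := se; have ve : b v e = 0 by rewrite b_sym.
suff -> : eichler e ((- k / a) *: v) v = v + k *: e by [].
rewrite /eichler !biscalarE ve (root_norm rv).
vector_field.
Qed.

(** A frame is a hyperbolic pair e, f and a root w orthogonal to it, such that N
    contains the Eichler transformations that generate the commutator subgroup of
    the orthogonal group of their span. *)
Definition frame e f w : Prop :=
  [/\ [/\ b e e = 0, b f f = 0 & b e f = 1], b w e = 0 /\ b w f = 0, is_root w,
      siegel e w & siegel f w].

Lemma frameC e f w : frame e f w -> frame f e w.
Proof. by case=> -[ee ff ef] [we wf] rw se sf; split=> //; split=> //; rewrite b_sym. Qed.

Lemma frameE e f w : frame e f w ->
  ((b e e = 0) * (b f f = 0) * (b e f = 1) * (b f e = 1)) *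
  ((b w e = 0) * (b e w = 0) * (b w f = 0) * (b f w = 0) * (b w w = a)).
Proof.
case=> -[ee ff ef] [we wf] /root_norm ww _ _.
by do !split; rewrite // b_sym.
Qed.

(** The reflection of u sends e to a multiple of the second isotropic vector f,
    and conjugates E_{e,v} to an Eichler transformation of f; w is the common
    projection of v and of its image onto the orthogonal of e and f. *)
Lemma frame_exists e v u :
    is_root v -> siegel e v -> is_root u -> b u e != 0 ->
  exists e' f w, frame e' f w.
Proof.
move=> rv sev ru nzue; have /and3P[/eqP ee /eqP ev _] := sev.
have uu := root_norm ru; have vv := root_norm rv.
have ve : b v e = 0 by rewrite b_sym.
pose k := - (2 / a * b u e ^+ 2).
have nzk : k != 0 by rewrite oppr_eq0 !mulf_neq0 ?invr_eq0.
have [f Df] : exists f, f = k^-1 *: reflection u e by exists (k^-1 *: reflection u e).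
have sfv : siegel f (reflection u v) by rewrite Df; apply/siegelZl/siegel_reflection.
have /and3P[/eqP ff _ _] := sfv.
have ef : b e f = 1.
  rewrite Df /reflection !biscalarE ee (b_sym e u) uu /k.
  by field; do ?[apply/andP; split]; rewrite ?oppr_eq0 ?mulf_neq0 ?expf_neq0.
have vf : b v f = b v u / b u e.
  rewrite Df /reflection !biscalarE ve (b_sym e u) uu /k.
  by field; do ?[apply/andP; split]; rewrite ?oppr_eq0 ?mulf_neq0 ?expf_neq0.
exists e, f, (v - b v f *: e); rewrite -scaleNr; split.
- by split.
- by rewrite !biscalarE ve ef ee; split; [ring | rewrite mulr1 subrr].
- exact: root_shift sev rv.
- by apply: siegelD sev _; apply/siegelZ/siegel_self.
- have -> : v + - b v f *: e = reflection u v - (b v u / b u e * k) *: f.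
    rewrite vf Df scalerA mulfK // /reflection (b_sym e u) uu.
    vector_field.
  by apply: siegelB sfv _; apply/siegelZ/siegel_self.
Qed.

(** The orthogonal projection of x onto the orthogonal of the frame. *)
Definition frame_comp e f w x : V :=
  x - b x f *: e - b x e *: f - (b x w / a) *: w.

Lemma frame_comp_orth e f w x : frame e f w ->
  [/\ b (frame_comp e f w x) e = 0, b (frame_comp e f w x) f = 0
    & b (frame_comp e f w x) w = 0].
Proof.
move=> fr; rewrite /frame_comp !biscalarE !(frameE fr).
by split; field.
Qed.

Lemma frame_compE e f w x :
  x = b x f *: e + b x e *: f + (b x w / a) *: w + frame_comp e f w x.
Proof. vector_ring. Qed.

(** With c != 0, the transformations E_{f, t w} act transitively on the vectors of
    given norm with given coefficient c along e and given projection y. *)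
Lemma frame_move e f w y c d r d' r' :
    frame e f w -> b y e = 0 -> b y f = 0 -> b y w = 0 -> c != 0 ->
    2 * c * d + a * r ^+ 2 = 2 * c * d' + a * r' ^+ 2 ->
    is_root (c *: e + d *: f + r *: w + y) ->
  is_root (c *: e + d' *: f + r' *: w + y).
Proof.
move=> fr ye yf yw nzc eq_norm; have [_ _ _ _ sf] := fr.
move/(root_eichler (siegelZ ((r' - r) / c) sf)).
suff -> : eichler f (((r' - r) / c) *: w) (c *: e + d *: f + r *: w + y) =
  c *: e + d' *: f + r' *: w + y by [].
have -> : d' = d + a * (r ^+ 2 - r' ^+ 2) / (2 * c).
  apply: (mulfI (mulf_neq0 F2 nzc)).
  have -> : 2 * c * d' = 2 * c * d + a * (r ^+ 2 - r' ^+ 2).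
    by rewrite mulrBr addrA eq_norm addrK.
  by field; apply/andP; split.
rewrite /eichler !biscalarE !(frameE fr) yf yw.
vector_field.
Qed.

Lemma frame_root e f w c d r :
  frame e f w -> d != 0 -> 2 * c * d + a * r ^+ 2 = a -> is_root (c *: e + d *: f + r *: w).
Proof.
move=> fr nzd norm; have [_ _ rw _ sf] := fr.
have := root_shift d sf rw; rewrite -[_ + _]addr0 => rwd.
have rwd' : is_root (d *: f + 0 *: e + 1 *: w + 0).
  by rewrite scale0r scale1r !addr0 addrC -[_ + _]addr0.
rewrite -[_ + _]addr0 [c *: e + _]addrC.
apply: (frame_move (frameC fr) _ _ _ nzd _ rwd'); rewrite ?biscalarE //.
by rewrite [2 * d * c]mulrAC norm; ring.
Qed.

(** The reflection of e + (a / 2) f exchanges the lines of e and f, and fixes y. *)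
Lemma frame_swap e f w y :
    frame e f w -> b y e = 0 -> b y f = 0 -> b y w = 0 ->
  siegel e y -> siegel f y.
Proof.
move=> fr ye yf yw sy.
have nzh : a / 2 != 0 by rewrite mulf_neq0 ?invr_eq0.
have norm : 2 * 1 * (a / 2) + a * 0 ^+ 2 = a by field.
have rx := frame_root fr nzh norm; have := siegel_reflection rx sy.
have -> : reflection (1 *: e + (a / 2) *: f + 0 *: w) e = - (a / 2) *: f.
  rewrite /reflection (root_norm rx) !biscalarE !(frameE fr).
  vector_field.
have -> : reflection (1 *: e + (a / 2) *: f + 0 *: w) y = y.
  by rewrite /reflection (root_norm rx) !biscalarE ye yf yw !(mulr0, addr0, mul0r, scale0r, subr0).
have nzh' : - (a / 2) != 0 by rewrite oppr_eq0.
by move/(siegelZl (- (a / 2))^-1); rewrite scalerA (mulVf nzh') scale1r.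
Qed.

(** * Extending a frame to the whole space *)

Hypothesis F3 : 3 != 0 :> F.

(** This s is the slope of a line M = s (Z + 1) that meets the conic
    Z ^ 2 + k M ^ 2 = 1 in a second point, with M != 0; as 3 != 0, s can be chosen
    in {1, 2}. *)
Lemma conic_point k : exists2 s, s != 0 & 1 + k * s ^+ 2 != 0.
Proof.
have [k1 | ] := eqVneq (1 + k * 1 ^+ 2) 0; last by exists 1; rewrite ?oner_eq0.
exists 2 => //; have -> : 1 + k * 2 ^+ 2 = 2 * 2 * (1 + k * 1 ^+ 2) - 3 by ring.
by rewrite k1 mulr0 sub0r oppr_eq0.
Qed.

(** The root c e + y can be moved into roots d f + y for several values of d,
    namely d = - a t ^ 2 / (2 c); two of these roots differ by a multiple of f. *)
Lemma siegel_of_degenerate_root e f w c y :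
    frame e f w -> b y e = 0 -> b y f = 0 -> b y w = 0 -> c != 0 ->
  is_root (c *: e + y) -> siegel f y.
Proof.
move=> fr ye yf yw nzc rcy.
have orbit t : t != 0 -> is_root (- (a * t ^+ 2 / (2 * c)) *: f + y).
  move=> nzt; have nzd : - (a * t ^+ 2 / (2 * c)) != 0.
    by rewrite oppr_eq0 mulf_neq0 ?invr_eq0 ?mulf_neq0 ?expf_neq0.
  have rcy' : is_root (c *: e + 0 *: f + 0 *: w + y) by rewrite !scale0r !addr0.
  have eq1 : 2 * c * 0 + a * 0 ^+ 2 = 2 * c * - (a * t ^+ 2 / (2 * c)) + a * t ^+ 2.
    by field; apply/andP.
  have := frame_move fr ye yf yw nzc eq1 rcy'; rewrite [c *: e + _]addrC.
  have eq2 : 2 * - (a * t ^+ 2 / (2 * c)) * c + a * t ^+ 2 =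
             2 * - (a * t ^+ 2 / (2 * c)) * 0 + a * 0 ^+ 2.
    by field; apply/andP.
  move/(frame_move (frameC fr) yf ye yw nzd eq2).
  by rewrite !scale0r !addr0.
have nzone : 1 != 0 :> F := oner_neq0 F.
have r1 := orbit 1 nzone; have r2 := orbit 2 F2.
have ff : b f f = 0 by rewrite (frameE fr).
pose k := - (3 * a / (2 * c)).
have nzk : k != 0 by rewrite oppr_eq0 !mulf_neq0 ?invr_eq0 ?mulf_neq0.
have r12 : is_root (- (a * 1 ^+ 2 / (2 * c)) *: f + y + k *: f).
  suff -> : - (a * 1 ^+ 2 / (2 * c)) *: f + y + k *: f =
            - (a * 2 ^+ 2 / (2 * c)) *: f + y by [].
  rewrite /k; vector_field.
have ffy : b f (- (a * 1 ^+ 2 / (2 * c)) *: f + y) = 0.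
  by rewrite !biscalarE ff (b_sym f y) yf mulr0 addr0.
have := siegelB (siegel_of_roots ff ffy nzk r1 r12)
                (siegelZ (- (a * 1 ^+ 2 / (2 * c))) (siegel_self ff)).
by rewrite addrC addrA addNr add0r.
Qed.

(** The root u = c e + d f + r w + y sends the root w + t f to a root with the
    projection q y, where q != 0 depends on the pairing m of w + t f with u. As t
    varies, m is arbitrary; the norm of the part of the new root in the span of
    the frame is a (1 - k m ^ 2) with k = 4 b y y / a ^ 3. With m on the conic of
    [conic_point] this is a z ^ 2, so [frame_move] yields the root
    q c e + z w + q y. It is orthogonal to e, and its translates along e are
    also roots: by E_{e,w} if z != 0, by [siegel_of_degenerate_root] if z = 0. *)
Lemma siegel_of_root e f w y c d r :
    frame e f w -> b y e = 0 -> b y f = 0 -> b y w = 0 -> c != 0 ->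
    is_root (c *: e + d *: f + r *: w + y) ->
  siegel e y.
Proof.
move=> fr ye yf yw nzc ru; have [_ _ rw sew sfw] := fr.
have norm : 2 * c * d + a * r ^+ 2 + b y y = a.
  rewrite -[RHS](root_norm ru) !biscalarE !(frameE fr) (b_sym e y) (b_sym f y).
  by rewrite (b_sym w y) ye yf yw; ring.
have [s nzs nzD] := conic_point (4 * b y y / a ^+ 3).
set D := 1 + _ in nzD.
have nz4 : 4 != 0 :> F by have := mulf_neq0 F2 F2; rewrite -natrM.
have yy : b y y = (D - 1) * a ^+ 3 / (4 * s ^+ 2).
  by rewrite /D; field; do ?[apply/andP; split].
pose m := 2 * s / D; pose t := (m - r * a) / c.
pose q := - (2 * m / a); pose z := (2 - D) / D.
have nzm : m != 0 by rewrite !mulf_neq0 ?invr_eq0.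
have nzq : q != 0 by rewrite oppr_eq0 !mulf_neq0 ?invr_eq0.
have nzqc : q * c != 0 by rewrite mulf_neq0.
have r1 := root_reflection ru (root_shift t sfw rw).
have {}r1 : is_root ((q * c) *: e + (t + q * d) *: f + (1 + q * r) *: w + q *: y).
  suff <- : reflection (c *: e + d *: f + r *: w + y) (w + t *: f) =
    (q * c) *: e + (t + q * d) *: f + (1 + q * r) *: w + q *: y by [].
  rewrite /reflection (root_norm ru).
  have -> : b (w + t *: f) (c *: e + d *: f + r *: w + y) = m.
    rewrite !biscalarE !(frameE fr) (b_sym f y) (b_sym w y) yf yw /t.
    by field.
  rewrite /q; vector_field.
have qye : b (q *: y) e = 0 by rewrite biscalarE ye mulr0.
have qyf : b (q *: y) f = 0 by rewrite biscalarE yf mulr0.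
have qyw : b (q *: y) w = 0 by rewrite biscalarE yw mulr0.
have eq1 : 2 * (q * c) * (t + q * d) + a * (1 + q * r) ^+ 2 =
           2 * (q * c) * 0 + a * z ^+ 2.
  rewrite mulr0 add0r.
  have -> : 2 * (q * c) * (t + q * d) + a * (1 + q * r) ^+ 2 =
     a + 2 * q * (c * t + r * a) + q ^+ 2 * (2 * c * d + a * r ^+ 2) by ring.
  have -> : 2 * c * d + a * r ^+ 2 = a - b y y by rewrite -[in RHS]norm addrK.
  have -> : c * t + r * a = m by rewrite /t; field.
  rewrite yy /q /m /z; move: D nzD {yy m t q z nzm nzq nzqc r1 qye qyf qyw} => D nzD.
  by field; do ?[apply/andP; split].
have r2 := frame_move fr qye qyf qyw nzqc eq1 r1.
apply: (siegelZr nzq).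
have [z0 | nzz] := eqVneq z 0.
  apply: (frame_swap (frameC fr) qyf qye qyw).
  apply: (siegel_of_degenerate_root fr qye qyf qyw nzqc).
  by move: r2; rewrite z0 !scale0r !addr0.
have {}r2 : is_root ((q * c) *: e + z *: w + q *: y).
  by move: r2; rewrite scale0r addr0.
have ee : b e e = 0 by rewrite (frameE fr).
have eu : b e ((q * c) *: e + z *: w + q *: y) = 0.
  by rewrite !biscalarE !(frameE fr) (b_sym e y) ye !mulr0 !addr0.
have nzk : - (a * z) != 0 by rewrite oppr_eq0 mulf_neq0.
have r3 : is_root ((q * c) *: e + z *: w + q *: y + - (a * z) *: e).
  suff <- : eichler e w ((q * c) *: e + z *: w + q *: y) =
    (q * c) *: e + z *: w + q *: y + - (a * z) *: e by exact: root_eichler sew r2.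
  rewrite /eichler !biscalarE !(frameE fr) ye yw; vector_field.
have := siegelB (siegelB (siegel_of_roots ee eu nzk r2 r3)
  (siegelZ (q * c) (siegel_self ee))) (siegelZ z sew).
suff -> : (q * c) *: e + z *: w + q *: y - (q * c) *: e - z *: w = q *: y by [].
vector_ring.
Qed.

(** If u is orthogonal to f, then either exchanging e and f, or applying E_{e,w},
    reduces to [siegel_of_root]. *)
Lemma root_comp_siegel e f w u : frame e f w -> is_root u ->
    [|| b u e != 0, b u f != 0 | b u w != 0] ->
  siegel e (frame_comp e f w u).
Proof.
move=> fr ru; have [ye yf yw] := frame_comp_orth u fr.
move: ru; rewrite {1}[u](frame_compE e f w u).
have [fu0 | nzfu ru _] := eqVneq (b u f) 0; last first.
  exact: (siegel_of_root fr ye yf yw nzfu ru).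
have [eu0 | nzeu ru _] := eqVneq (b u e) 0; last first.
  apply: (frame_swap (frameC fr) yf ye yw).
  by apply: (siegel_of_root (frameC fr) yf ye yw nzeu); rewrite [b u e *: f + _]addrC; exact: ru.
rewrite /= fu0 eu0 => ru nzw; have [_ _ _ sew _] := fr.
have nzbw : - b u w != 0 by rewrite oppr_eq0.
apply: (siegel_of_root (d := 0) (r := b u w / a) fr ye yf yw nzbw).
suff <- : eichler e w (0 *: e + 0 *: f + (b u w / a) *: w + frame_comp e f w u) =
  - b u w *: e + 0 *: f + (b u w / a) *: w + frame_comp e f w u.
  exact: root_eichler sew ru.
move: (frame_comp e f w u) ye yf yw {ru} => y ye yf yw.
rewrite /eichler !biscalarE ye yw !(frameE fr).
vector_field.
Qed.

(** Connectedness spreads the property that the projection of a root u off the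
    frame satisfies siegel e: it holds for the roots that are not orthogonal to
    the frame, by [root_comp_siegel]. A root v orthogonal to the frame fixes e, so
    if u has the property and is not orthogonal to v, then conjugating by the
    reflection of v and subtracting yields siegel e v. *)
Lemma frame_siegel (G : {group GL}) e f w :
    mx_irreducible (natural_repr G) -> mx_primitive (natural_repr G) ->
    G \subset isom_group b -> G \subset 'N(N)%g ->
    (forall v, (forall u, b u v = 0) -> v = 0) ->
    frame e f w ->
  forall y, b e y = 0 -> siegel e y.
Proof.
move=> irrG primG sGb nNG b_nondeg fr.
have [_ _ rw sew _] := fr.
pose S : {set V} := [set v | is_root v].
have SE v : (v \in S) = is_root v by rewrite inE.
have GS g v : g \in G -> v \in S -> v *m GLval g \in S.
  by rewrite !SE => Gg; apply: root_normalizer; [apply: (subsetP sGb)|apply: (subsetP nNG)].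
have comp_w : frame_comp e f w w = 0.
  by rewrite /frame_comp !(frameE fr) !scale0r !subr0 divff // scale1r subrr.
have ee : b e e = 0 by rewrite (frameE fr).
have compS v : is_root v -> siegel e (frame_comp e f w v).
  move=> rv; have Sv : v \in S by rewrite SE.
  have Sw : w \in S by rewrite SE.
  have b_refl x y : b x y = 0 -> b y x = 0 by rewrite b_sym.
  apply: (primitive_connected irrG GS primG sGb b_nondeg b_refl
            (C := fun v => siegel e (frame_comp e f w v)) Sw (root_neq0 rw)
            _ _ Sv (root_neq0 rv)); first by rewrite comp_w; apply: siegel0.
  move=> {Sv rv} u {}v; rewrite !SE => ru rv nzuv su.
  have [nz|] := boolP [|| b v e != 0, b v f != 0 | b v w != 0].
    exact: root_comp_siegel fr rv nz.
  rewrite !negb_or !negbK => /and3P[/eqP ve /eqP vf /eqP vw].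
  have comp_v : frame_comp e f w v = v.
    by rewrite /frame_comp ve vf vw mul0r !scale0r !subr0.
  have := siegel_reflection rv su.
  have -> : reflection v e = e.
    by rewrite /reflection b_sym ve mulr0 mul0r scale0r subr0.
  rewrite /reflection (root_norm rv); move/siegelB => /(_ _ su).
  have -> : b (frame_comp e f w u) v = b u v.
    rewrite {2}[u](frame_compE e f w u).
    move: (frame_comp e f w u) => y.
    by rewrite !biscalarE (b_sym e) (b_sym f) (b_sym w) ve vf vw !mulr0 !add0r.
  rewrite addrAC subrr add0r -scaleNr comp_v; apply: siegelZr.
  by rewrite oppr_eq0 !mulf_neq0 ?invr_eq0.
have comp_all x : siegel e (frame_comp e f w x).
  apply: (irreducible_span_ind irrG GS (Q := fun x => siegel e (frame_comp e f w x))).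
  - by exists w; rewrite ?SE ?(root_neq0 rw).
  - suff -> : frame_comp e f w 0 = 0 by apply: siegel0.
    by rewrite /frame_comp !biscalarE mul0r !scale0r !subr0.
  - move=> y z sy sz; suff -> : frame_comp e f w (y + z) =
      frame_comp e f w y + frame_comp e f w z by apply: siegelD.
    rewrite /frame_comp !biscalarE; vector_ring.
  - move=> k y sy; suff -> : frame_comp e f w (k *: y) =
      k *: frame_comp e f w y by apply: siegelZ.
    rewrite /frame_comp !biscalarE; vector_ring.
  - by move=> v; rewrite SE; apply: compS.
move=> y ey; rewrite [y](frame_compE e f w y) (b_sym y e) ey scale0r addr0.
apply: siegelD (comp_all y); apply: siegelD; apply: siegelZ.
  exact: siegel_self.
exact: sew.
Qed.

(** * The orthogonal group from reflections of one norm *)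

Section FullSiegel.

Variables e f w : V.
Hypothesis fr : frame e f w.
Hypothesis sieg_e : forall y, b e y = 0 -> siegel e y.
Hypothesis sieg_f : forall y, b f y = 0 -> siegel f y.
Hypothesis b_nondeg : forall v, (forall u, b u v = 0) -> v = 0.

Let ee : b e e = 0. Proof. by rewrite (frameE fr). Qed.
Let ff : b f f = 0. Proof. by rewrite (frameE fr). Qed.
Let ef : b e f = 1. Proof. by rewrite (frameE fr). Qed.
Let fe : b f e = 1. Proof. by rewrite (frameE fr). Qed.

Lemma hyperbolic_root t : t != 0 -> is_root (t *: e + (a / (2 * t)) *: f).
Proof.
move=> nzt; have nzd : a / (2 * t) != 0 by rewrite mulf_neq0 ?invr_eq0 ?mulf_neq0.
have norm : 2 * t * (a / (2 * t)) + a * 0 ^+ 2 = a by field; apply/andP.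
by have := frame_root fr nzd norm; rewrite scale0r addr0.
Qed.

Lemma move_off_e_perp x : x != 0 -> exists2 g, g \in N & b (x *m GLval g) e != 0.
Proof.
move=> nzx; have [xe|] := eqVneq (b x e) 0; last first.
  by exists 1%g; rewrite ?group1 ?mulGL1.
have [xf|nzxf] := eqVneq (b x f) 0; last first.
  have rx := hyperbolic_root (oner_neq0 F).
  case/andP: (rx) => xx /realizedP[g Ng gE]; exists g => //.
  rewrite gE; suff -> : b (reflection (1 *: e + (a / (2 * 1)) *: f) x) e = - (a / 2) * b x f.
    by rewrite mulf_neq0 // oppr_eq0 mulf_neq0 ?invr_eq0.
  rewrite reflection_pairing ?(eqP xx) // /reflection (eqP xx) !biscalarE ee ef xe.
  by field; apply/andP.
have [z nzxz] : exists z, b x z != 0.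
  apply/existsP; apply: contraNT nzx; rewrite negb_exists => /forallP xz.
  by apply/eqP/b_nondeg => u; rewrite b_sym; apply/eqP; have := xz u; rewrite negbK.
pose y := z - b z e *: f - b z f *: e.
have fy : b f y = 0 by rewrite /y !biscalarE ff fe (b_sym f z); ring.
have ye : b y e = 0 by rewrite /y !biscalarE ee fe; ring.
have xy : b x y = b x z by rewrite /y !biscalarE xe xf; ring.
have /and3P[_ _ /realizedP[g Ng gE]] := sieg_f fy; exists g => //.
rewrite gE; move: {gE} y fy ye xy => y fy ye xy.
by rewrite /eichler xf !biscalarE xe ye xy fe !(mulr0, add0r, addr0, mulr1) oppr_eq0.
Qed.

(** Once x is not orthogonal to e, a transformation E_{e,z} replaces the component
    of x orthogonal to e and f by any other, as z is arbitrary there. *)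
Lemma hyperbolic_normal_form x y : x != 0 -> b y e = 0 -> b y f = 0 ->
  exists g c d, [/\ g \in N, d != 0, 2 * c * d + b y y = b x x
                  & x *m GLval g = c *: e + d *: f + y].
Proof.
move=> nzx ye yf; have [g Ng nzd] := move_off_e_perp nzx.
have bxg : b (x *m GLval g) (x *m GLval g) = b x x.
  by rewrite (isom_setP _ _ (subsetP sNb g Ng)).
have [x1 Dx1] : exists x1, x1 = x *m GLval g by exists (x *m GLval g).
rewrite -Dx1 in nzd bxg.
pose y1 := x1 - b x1 f *: e - b x1 e *: f.
have y1e : b y1 e = 0 by rewrite /y1 !biscalarE ee fe; ring.
have y1f : b y1 f = 0 by rewrite /y1 !biscalarE ff ef; ring.
have Dy1 : x1 = b x1 f *: e + b x1 e *: f + y1 by rewrite /y1; vector_ring.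
move: y1 y1e y1f Dy1 => y1 y1e y1f Dy1.
have ez : b e ((b x1 e)^-1 *: (y - y1)) = 0.
  by rewrite b_sym !biscalarE ye y1e subr0 mulr0.
have /and3P[_ _ /realizedP[h Nh hE]] := sieg_e ez.
exists (g * h)%g, (b x1 f + (b y1 y1 - b y y) / (2 * b x1 e)), (b x1 e).
split; rewrite ?groupM //.
  rewrite -bxg; move: (b x1 f) (b x1 e) nzd Dy1 => c d nzd ->.
  rewrite !biscalarE (b_sym e y1) (b_sym f y1) !(ee, ff, ef, fe, y1e, y1f).
  by field; apply/andP.
rewrite mulGL -Dx1 hE.
move: (b x1 f) (b x1 e) nzd Dy1 {ez hE} => c d nzd ->.
rewrite /eichler !biscalarE (b_sym e y) (b_sym f y) (b_sym e y1) (b_sym f y1).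
rewrite (b_sym y1 y) !(ee, fe, ye, yf, y1e, y1f).
vector_field.
Qed.

(** With y = w, the normal form of a vector of norm a is w + d f. *)
Lemma norm_root x : b x x = a -> is_root x.
Proof.
move=> xx; have nzx : x != 0.
  by apply: contraNneq nza => x0; rewrite -xx x0 biscalarE.
have [_ [we wf] rw _ sfw] := fr.
have [g [c [d [Ng nzd norm xg]]]] := hyperbolic_normal_form nzx we wf.
have c0 : c = 0.
  have : 2 * c * d == 0 by rewrite -[2 * c * d](addrK (b w w)) norm (root_norm rw) xx subrr.
  by rewrite !mulf_eq0 (negPf F2) (negPf nzd) orbF => /eqP.
by apply: (is_root_act Ng); rewrite xg c0 scale0r add0r addrC; apply: root_shift sfw rw.
Qed.

(** With y = 0, the normal form of an isotropic vector is d f. *)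
Lemma isotropic_siegel x y : b x x = 0 -> b x y = 0 -> siegel x y.
Proof.
move=> xx xy; have [->|nzx] := eqVneq x 0.
  rewrite /siegel !biscalarE eqxx; apply: eq_realized (realized_id N) => z.
  by rewrite /eichler !biscalarE scale0r scaler0 addr0 subr0.
have [||g [c [d [Ng nzd norm xg]]]] := hyperbolic_normal_form (y := 0) nzx.
- by rewrite biscalarE.
- by rewrite biscalarE.
have c0 : c = 0.
  have : 2 * c * d == 0 by rewrite -[2 * c * d](addrK (b 0 0)) norm xx biscalarE subr0.
  by rewrite !mulf_eq0 (negPf F2) (negPf nzd) orbF => /eqP.
have{}xg : x *m GLval g = d *: f by rewrite xg c0 scale0r add0r addr0.
apply: (siegel_act Ng); rewrite xg; apply/siegelZl/sieg_f; apply: (mulfI nzd).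
have /isom_setP bg := subsetP sNb g Ng.
by have := bg x y; rewrite xg biscalarE xy mulr0.
Qed.

(** The product of the reflections of two vectors of norm c in the hyperbolic
    plane does not depend on c: so it is in N whatever the class of c. *)
Lemma reflection_pair_torus c t x : c != 0 -> t != 0 ->
  reflection (1 *: e + (c / (2 * 1)) *: f) (reflection (t *: e + (c / (2 * t)) *: f) x) =
    x + ((t ^- 2 - 1) * b x f) *: e + ((t ^+ 2 - 1) * b x e) *: f.
Proof.
move=> nzc nzt.
have norm s : s != 0 ->
    b (s *: e + (c / (2 * s)) *: f) (s *: e + (c / (2 * s)) *: f) = c.
  by move=> nzs; rewrite !biscalarE ee ff ef fe; field; apply/andP.
rewrite /reflection !norm ?oner_neq0 // !biscalarE !(ee, ff, ef, fe).
vector_field.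
Qed.

(* The root of r0 has norm c; it is t e + c / (2 t) f for t = 1. *)
Variables (c : F) (r0 : GL).
Hypothesis nzc : c != 0.
Hypothesis r0E : forall x, x *m GLval r0 = reflection (1 *: e + (c / (2 * 1)) *: f) x.
Hypothesis norm_classes : forall d, d != 0 ->
  exists2 s, s != 0 & d = a * s ^+ 2 \/ d = c * s ^+ 2.
Hypothesis nON : isom_group b \subset 'N(N)%g.

Let uu : b (1 *: e + (c / (2 * 1)) *: f) (1 *: e + (c / (2 * 1)) *: f) = c.
Proof. by rewrite !biscalarE ee ff ef fe; field. Qed.

Let r0_isom : r0 \in isom_group b.
Proof. by apply/isom_setP=> x y; rewrite !r0E reflection_isom ?uu. Qed.

Let r0K : (r0 * r0)%g = 1%g.
Proof. by apply: GL_ext => x; rewrite mulGL !r0E reflectionK ?uu ?mulGL1. Qed.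

Let nNr0 : r0 \in 'N(N)%g := subsetP nON r0 r0_isom.

(** Up to conjugation by N, the vector z of norm c is in the hyperbolic plane,
    where [reflection_pair_torus] applies to z and the root of r0. *)
Lemma other_reflection z h :
  b z z = c -> (forall x, x *m GLval h = reflection z x) -> (h * r0)%g \in N.
Proof.
move=> zz hE; have nzz : z != 0.
  by apply: contraNneq nzc => z0; rewrite -zz z0 biscalarE.
have [g [s [d [Ng nzd norm zg]]]] :=
  hyperbolic_normal_form nzz (linear0l b e) (linear0l b f).
rewrite biscalarE addr0 zz in norm; rewrite addr0 in zg.
have nzs : s != 0.
  by apply: contraNneq nzc => s0; rewrite -norm s0 mulr0 mul0r.
have Dd : d = c / (2 * s) by rewrite -norm; field; apply/andP.
rewrite {}Dd {nzd norm} in zg.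
have bg := isom_setP _ _ (subsetP sNb g Ng).
have hgE x : x *m GLval (h ^ g)%g = reflection (s *: e + (c / (2 * s)) *: f) x.
  rewrite conjgE !mulGL hE -zg -{2}[x](mulGLVK g).
  by rewrite /reflection !bg mulmxBl -scalemxAl.
have /andP[_ r1] := hyperbolic_root (oner_neq0 F).
have /andP[_ rs] := hyperbolic_root nzs.
have /realizedP[k Nk kE] := realized_comp rs r1.
have Dk : (h ^ g * r0)%g = k.
  by apply: GL_ext => x; rewrite kE mulGL hgE r0E /= !reflection_pair_torus.
apply: (involution_conj r0K nNr0 Ng); rewrite Dk; exact: Nk.
Qed.

Let inN2 g := g \in N \/ (g * r0)%g \in N.

Lemma reflection_in_cosets z h : b z z != 0 ->
  (forall x, x *m GLval h = reflection z x) -> inN2 h.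
Proof.
move=> nzz hE; have [s nzs zz] := norm_classes nzz.
have nzs' : s^-1 != 0 by rewrite invr_eq0.
have hE' x : x *m GLval h = reflection (s^-1 *: z) x by rewrite hE reflectionZ.
case: zz => zz; [left | right]; last first.
  by apply: other_reflection hE'; rewrite !biscalarE zz; field.
have /norm_root/andP[_ /realizedP[k Nk kE]] : b (s^-1 *: z) (s^-1 *: z) = a.
  by rewrite !biscalarE zz; field.
by suff -> : h = k by []; apply: GL_ext => x; rewrite kE hE'.
Qed.

(** Let x be moved by g. If z = y g - y is anisotropic for some y, then the
    reflection of z maps y g back to y and fixes the fixed vectors of g, which are
    orthogonal to z. Otherwise the image of g - 1 is totally isotropic; it contains
    e1 = x g - x and some y with b x y = 1, and E_{e1,y} maps x g = x + e1 back
    to x, and again fixes the fixed vectors of g. *)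
Lemma orthogonal_cosets g : g \in isom_group b -> g \in N \/ (g * r0)%g \in N.
Proof.
move: g; apply: (@moved_ind _ _ _ inN2) => [|g x Og xg]; first by left; apply: group1.
have bg := isom_setP _ _ Og.
have fix_orth y z : y *m GLval g = y -> b y (z *m GLval g - z) = 0.
  by move=> yg; rewrite !biscalarE -{1}yg bg subrr.
have [/existsP[y nzz] | ] :=
  boolP [exists y, b (y *m GLval g - y) (y *m GLval g - y) != 0].
  have [z Dz] : exists z, z = y *m GLval g - y by exists (y *m GLval g - y).
  rewrite -Dz in nzz.
  have [h hE] := involutive_GL (reflection_linear z) (reflectionK nzz).
  exists h; split.
  - by apply/isom_setP=> u v; rewrite !hE reflection_isom.
  - apply: (@moved_proper _ _ _ _ y) => [u ug||].
    + by rewrite hE /reflection Dz fix_orth // mulr0 mul0r scale0r subr0.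
    + by apply: contraNneq nzz => yg; rewrite Dz yg subrr biscalarE.
    rewrite hE /reflection; have -> : 2 * b (y *m GLval g) z = b z z.
      by rewrite Dz !biscalarE bg (b_sym y (y *m GLval g)); ring.
    by rewrite divff // scale1r Dz opprB addrC subrK.
  - exact: (involution_cosets r0K nNr0 (reflection_in_cosets nzz hE)).
rewrite negb_exists => /forallP im0.
have{}im0 y : b (y *m GLval g - y) (y *m GLval g - y) = 0.
  by apply/eqP; have := im0 y; rewrite negbK.
have [z nzxz] : exists z, b x (z *m GLval g - z) != 0.
  apply/existsP; apply: contraNT xg; rewrite negb_exists => /forallP xz.
  rewrite -subr_eq0; apply/eqP/b_nondeg => u.
  have := xz (u *m GLval g^-1%g); rewrite negbK mulGLVK => /eqP xu.
  rewrite b_sym -[u](mulGLVK g) !biscalarE bg mulGLVK.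
  by move: xu; rewrite !biscalarE => /eqP; rewrite subr_eq0 => /eqP ->; rewrite subrr.
have [e1 De1] : exists e1, e1 = x *m GLval g - x by exists (x *m GLval g - x).
have [y1 Dy1] : exists y1, y1 = z *m GLval g - z by exists (z *m GLval g - z).
have e11 : b e1 e1 = 0 by rewrite De1 im0.
have ey1 : b e1 y1 = 0.
  have := im0 (x + z); rewrite mulmxDl opprD addrACA -De1 -Dy1 !biscalarE.
  have y11 : b y1 y1 = 0 by rewrite Dy1 im0.
  rewrite e11 y11 add0r addr0 (b_sym y1) -mulr2n -mulr_natl => /eqP.
  by rewrite mulf_eq0 (negPf F2) => /eqP.
rewrite -Dy1 in nzxz.
have xge1 : b (x *m GLval g) e1 = 0.
  have : 2 * b (x *m GLval g) e1 = b e1 e1.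
    by rewrite De1 !biscalarE bg (b_sym x (x *m GLval g)); ring.
  by rewrite e11 => /eqP; rewrite mulf_eq0 (negPf F2) => /eqP.
have Dxg : x *m GLval g = x + e1 by rewrite De1 addrC subrK.
have ey : b e1 ((b x y1)^-1 *: y1) = 0 by rewrite biscalarE ey1 mulr0.
have /and3P[_ _ /realizedP[h Nh hE]] := isotropic_siegel e11 ey.
exists h; split; first exact: (subsetP sNb).
- apply: (@moved_proper _ _ _ _ x) => [u ug|//|].
    have ue : b u e1 = 0 by rewrite De1 fix_orth.
    have uy : b u y1 = 0 by rewrite Dy1 fix_orth.
    by rewrite hE /eichler !biscalarE ue uy !mulr0 addr0 !scale0r addr0 subr0.
  rewrite hE /eichler xge1 mulr0 scale0r !addr0 Dxg !biscalarE ey1 mulr0 addr0 mulVf //.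
  by rewrite scale1r addrK.
- exact: (involution_cosets r0K nNr0 (or_introl Nh)).
Qed.

End FullSiegel.

End ReflectionGroup.

End Orthogonal.

(** * Reflections as matrices, and classes of norms *)

Section ReflectionMatrices.

Variables (F : finFieldType) (n : nat) (b : {biscalar 'rV[F]_n.+1}).
Notation V := 'rV[F]_n.+1.
Notation GL := {'GL_n.+1[F]}.
Hypothesis F2 : 2 != 0 :> F.
Hypothesis b_sym : symmetric_pairing b.

Lemma det_1_sub_rank1 m (C : 'cV[F]_m) (R : 'rV[F]_m) :
  \det (1%:M - C *m R) = 1 - (R *m C) 0 0.
Proof.
pose L := block_mx (1%:M : 'M[F]_1) R C 1%:M.
have L1 : L = block_mx 1%:M 0 C 1%:M *m block_mx 1%:M R 0 (1%:M - C *m R).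
  rewrite mulmx_block !(mul1mx, mulmx1, mul0mx, mulmx0, addr0).
  by rewrite [C *m R + _]addrC subrK.
have L2 : L = block_mx 1%:M R 0 1%:M *m block_mx (1%:M - R *m C) 0 C 1%:M.
  rewrite mulmx_block !mul1mx !mulmx1 !mul0mx !add0r.
  by rewrite subrK.
have := congr1 determinant L2; rewrite L1 !det_mulmx !det_lblock !det_ublock !det1 !mul1r mulr1.
by move->; rewrite det_mx11 !mxE eqxx.
Qed.

(** Write x g = x + k v. As g is an isometry, b v v = 0 would force k = 0 for all
    x; otherwise v g = - v, and pairing x g with v g determines k. *)
Lemma isom_drop1_reflection (g : GL) :
    (forall v, (forall u, b u v = 0) -> v = 0) ->
    g \in isom_group b -> drop_of g = 1%N ->
  exists2 v, b v v != 0 & forall x, x *m GLval g = reflection b v x.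
Proof.
move=> b_nondeg /isom_setP bg drop1; have [v nzv gE] := drop1_rank drop1.
have moved k l x y : x *m GLval g = x + k *: v -> y *m GLval g = y + l *: v ->
    k * b y v + l * b x v + k * l * b v v = 0.
  move=> xg yg; have := bg x y; rewrite xg yg !biscalarE (b_sym v y) => /eqP.
  by rewrite -subr_eq0 => /eqP <-; ring.
have [y nzyv] := nonorth_exists b_nondeg nzv.
have nontriv := drop1_moves drop1.
have [l vg] := gE v; have [m yg] := gE y.
have nzvv : b v v != 0.
  apply/eqP=> vv; apply: nontriv => x; have [k xg] := gE x.
  have := moved _ _ _ _ yg yg; rewrite vv mulr0 addr0 -mulr2n -mulr_natl => /eqP.
  rewrite !mulf_eq0 (negPf F2) (negPf nzyv) orbF => /eqP m0.
  have := moved _ _ _ _ xg yg; rewrite vv m0 mulr0 mul0r !addr0 => /eqP.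
  by rewrite mulf_eq0 (negPf nzyv) orbF => /eqP k0; rewrite xg k0 scale0r addr0.
exists v => // x; have [k xg] := gE x.
have l2 : l = -2.
  have := moved _ _ _ _ vg vg; have -> : l * b v v + l * b v v + l * l * b v v =
    l * (l + 2) * b v v by ring.
  move/eqP; rewrite !mulf_eq0 (negPf nzvv) orbF => /orP[/eqP l0|]; last first.
    by rewrite addr_eq0 => /eqP.
  case: nontriv => z; have [j zg] := gE z.
  have := moved _ _ _ _ zg vg; rewrite l0 mulr0 !mul0r !addr0 => /eqP.
  by rewrite mulf_eq0 (negPf nzvv) orbF => /eqP j0; rewrite zg j0 scale0r addr0.
rewrite xg /reflection -scaleNr; congr (_ + _ *: v).
have := moved _ _ _ _ xg vg; rewrite l2 => eq_k.
apply: (mulIf nzvv); rewrite mulNr divfK //.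
by apply/eqP; rewrite -subr_eq0 -oppr_eq0 -eq_k; apply/eqP; ring.
Qed.

Lemma reflection_isP (g : GL) v : b v v != 0 ->
  (forall x, x *m GLval g = reflection b v x) -> is_reflection b g && root_of g v.
Proof.
move=> nzvv gE.
have nzv : v != 0 by apply: contraNneq nzvv => ->; rewrite biscalarE.
have vg : v *m GLval g = - v.
  by rewrite gE /reflection mulfK // scaler_nat mulr2n opprD addrA subrr add0r.
have Og : g \in isom_group b by apply/isom_setP=> x y; rewrite !gE reflection_isom.
pose phi (x : V) : 'rV[F]_1 := (2 * b x v / b v v)%:M.
have phiL : linear phi.
  move=> k x y; rewrite /phi !biscalarE; apply/matrixP=> i j.
  by rewrite !mxE !ord1 eqxx; ring.
pose phi' : {linear V -> 'rV[F]_1} := HB.pack phi (GRing.isLinear.Build F V _ _ phi phiL).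
have gM : GLval g = 1%:M - lin1_mx phi' *m v.
  apply/row_matrixP=> i; rewrite !rowE mulmxBr mulmx1 mulmxA mul_rV_lin1 /=.
  by rewrite gE mul_scalar_mx.
have det_g : \det (GLval g) = -1.
  rewrite gM det_1_sub_rank1 mul_rV_lin1 /= mxE eqxx mulr1n mulfK //.
  by rewrite opprD addrA subrr add0r.
have g1v : (GLval g - 1%:M :=: v)%MS.
  apply/eqmxP; rewrite gM addrAC subrr add0r -mulNmx submxMl /=.
  have vE : v = (- 2^-1 *: v) *m (- lin1_mx phi' *m v).
    rewrite mulmxA mulmxN -scalemxAl mul_rV_lin1 /= /phi mulfK // scaleNr opprK.
    by rewrite scale_scalar_mx mulVf // mul1mx.
  by rewrite {1}vE submxMl.
rewrite /is_reflection Og det_g eqxx andbT /root_of nzv.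
have -> : drop_of g == 1%N.
  by rewrite /drop_of /eigenspace mxrank_ker g1v rank_rV nzv subKn.
rewrite /=.
apply/andP; split=> /=; first by apply/eigenspaceP; rewrite vg scaleN1r.
apply/rV_subP=> x /eigenspaceP; rewrite gE scaleN1r /reflection => xg.
apply/sub_rVP; exists (b x v / b v v).
have /(congr1 (fun y => 2^-1 *: y)) : 2 *: x = (2 * b x v / b v v) *: v.
  by rewrite scaler_nat mulr2n -{2}[x]opprK -xg opprB addrC subrK.
by rewrite !scalerA mulVf // scale1r !mulrA mulVf // mul1r.
Qed.

(** The nonzero norms form two classes modulo squares; c represents the class
    that does not contain a. *)
Lemma norm_class_exists (a : F) : a != 0 ->
  exists2 c, c != 0 &
    square_class a * square_class c = -1 /\
    forall d, d != 0 -> exists2 s, s != 0 & d = a * s ^+ 2 \/ d = c * s ^+ 2.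
Proof.
move=> nza; have [k nsqk] := nonsquare_exists F2.
have nzk : k != 0 by have := nsqk 0; rewrite expr0n eq_sym.
have dichotomy (d : F) : (exists x, x ^+ 2 = d) \/ (forall x, x ^+ 2 != d).
  have [/existsP[x /eqP]|] := boolP [exists x : F, x ^+ 2 == d].
    by left; exists x.
  by rewrite negb_exists => /forallP; right.
have nonsq (d : F) : (forall x, x ^+ 2 != d) -> square_class d = -1.
  by move=> nsq; rewrite /square_class; case: existsP => // -[x] /eqP xd; case/eqP: (nsq x).
have sqr_neq0 (x d : F) : d != 0 -> x ^+ 2 = d -> x != 0.
  by move=> nzd xd; apply: contraNneq nzd => x0; rewrite -xd x0 expr0n.
have same_class (d p : F) : d != 0 -> p != 0 -> (exists x, x ^+ 2 = d * p) ->
    exists2 s, s != 0 & d = p * s ^+ 2.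
  move=> nzd nzp [x xdp]; exists (x / p).
    by rewrite mulf_neq0 ?invr_eq0 // (sqr_neq0 _ _ _ xdp) ?mulf_neq0.
  by rewrite expr_div_n xdp; field.
have [[t ta] | nsqa] := dichotomy a.
  exists k => //; split; first by rewrite -ta square_class_sqr mul1r nonsq.
  move=> d nzd; have [[x xd] | nsqd] := dichotomy d.
    have [|s nzs ds] := same_class d a nzd nza; last by exists s; [|left].
    by exists (x * t); rewrite exprMn xd ta.
  have [s nzs ds] := same_class d k nzd nzk (square_mul_nonsquare nsqd nsqk).
  by exists s; [|right].
exists 1; rewrite ?oner_neq0 //; split.
  by rewrite nonsq // -(expr1n F 2) square_class_sqr mulr1.
move=> d nzd; have [[x xd] | nsqd] := dichotomy d.
  by exists x; [apply: sqr_neq0 xd | right; rewrite mul1r].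
have [s nzs ds] := same_class d a nzd nza (square_mul_nonsquare nsqd nsqa).
by exists s; [|left].
Qed.

End ReflectionMatrices.

(** * Groups with a reflection and an isotropic shear *)

Section Assembly.

Variables (F : finFieldType) (n : nat) (b : {biscalar 'rV[F]_n.+1}).
Notation V := 'rV[F]_n.+1.
Notation GL := {'GL_n.+1[F]}.
Hypotheses (F2 : 2 != 0 :> F) (F3 : 3 != 0 :> F).
Hypothesis primeF : forall k : F, exists m : nat, k = m%:R.
Hypothesis b_sym : symmetric_pairing b.
Hypothesis b_perfect : perfect_pairing b.

Variable G : {group GL}.
Hypothesis irrG : mx_irreducible (natural_repr G).
Hypothesis primG : mx_primitive (natural_repr G).
Hypothesis sGb : G \subset isom_group b.

Let b_nondeg : forall v, (forall u, b u v = 0) -> v = 0 :=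
  @perfect_nondegenerate _ _ _ b_perfect.

Variable a : F.
Hypothesis nza : a != 0.

(** The reflections of G with a root of norm a; they generate a normal subgroup
    N of G. *)
Let X : {set GL} :=
  [set g in G | [exists v : V, (b v v == a) && [forall x, x *m GLval g == reflection b v x]]].

Let N : {group GL} := <<X>>%G.

Let XP g : reflect (g \in G /\ exists2 v, b v v = a &
  forall x, x *m GLval g = reflection b v x) (g \in X).
Proof.
rewrite inE; apply: (iffP andP) => -[Gg].
  case/existsP=> v /andP[/eqP vv /forallP gE]; split=> //; exists v => // x.
  exact/eqP.
case=> v vv gE; split=> //; apply/existsP; exists v; rewrite vv eqxx.
by apply/forallP=> x; rewrite gE.
Qed.

Let sXG : X \subset G.
Proof. by apply/subsetP=> g /XP[]. Qed.

Let sNG : N \subset G.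
Proof. by rewrite gen_subG. Qed.

Let sNb : N \subset isom_group b := subset_trans sNG sGb.

Let reflectionJ (g h : GL) v : h \in isom_group b ->
    (forall x, x *m GLval g = reflection b v x) ->
  forall x, x *m GLval (g ^ h)%g = reflection b (v *m GLval h) x.
Proof.
move=> /isom_setP bh gE x; rewrite conjgE !mulGL gE -{2}[x](mulGLVK h).
by rewrite /reflection !bh mulmxBl -scalemxAl.
Qed.

Let nNG : G \subset 'N(N)%g.
Proof.
apply: norms_gen; apply/subsetP=> h Gh; rewrite inE; apply/subsetP=> _ /imsetP[g Xg ->].
have [Gg [v vv gE]] := XP g Xg; have Oh := subsetP sGb h Gh.
apply/XP; split; first exact: groupJ.
by exists (v *m GLval h); [rewrite (isom_setP _ _ Oh) | apply: reflectionJ].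
Qed.

Hypothesis G_refl : exists2 v, b v v = a & realized G (reflection b v).
Hypothesis G_shear : exists2 g, g \in G & is_isotropic_shear b g.

Let G_root : exists v, is_root b N a v.
Proof.
have [v vv /realizedP[g Gg gE]] := G_refl; exists v.
rewrite /is_root vv eqxx; apply/realizedP; exists g => //.
by apply: mem_gen; apply/XP; split=> //; exists v.
Qed.

Let S : {set V} := [set v | is_root b N a v].

Let GS g v : g \in G -> v \in S -> v *m GLval g \in S.
Proof.
rewrite !inE => Gg; apply: root_normalizer; first exact: (subsetP sGb).
exact: (subsetP nNG).
Qed.

Let root_span (Q : V -> Prop) :
    Q 0 -> (forall x y, Q x -> Q y -> Q (x + y)) ->
    (forall k x, Q x -> Q (k *: x)) -> (forall v, is_root b N a v -> Q v) ->
  forall x, Q x.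
Proof.
move=> Q0 QD QZ QS; apply: (irreducible_span_ind irrG GS) => //.
  by have [v rv] := G_root; exists v; [rewrite inE | apply: root_neq0 nza _ rv].
by move=> v; rewrite inE; apply: QS.
Qed.

(** The shear s moves some root v, and e = v s - v is then isotropic and orthogonal
    to v. As v + e = v s is also a root, E_{e,v} is in N, and any root that is not
    orthogonal to e completes the frame. *)
Lemma shear_frame : exists e f w, frame b N a e f w.
Proof.
have [s Gs [Os s1 _ ss]] := G_shear; have bs := isom_setP _ _ Os.
have [v rv vs] : exists2 v, is_root b N a v & v *m GLval s != v.
  have [/existsP[v /andP[rv vs]]|] :=
    boolP [exists v, is_root b N a v && (v *m GLval s != v)]; first by exists v.
  rewrite negb_exists => /forallP fix_s; case/eqP: s1; apply: GL_ext => x.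
  rewrite mulGL1; move: x; apply: root_span => [|x y xs ys|k x xs|v rv].
  - by rewrite mul0mx.
  - by rewrite mulmxDl xs ys.
  - by rewrite -scalemxAl xs.
  - by apply/eqP; have := fix_s v; rewrite rv negbK.
have [e De] : exists e, e = v *m GLval s - v by exists (v *m GLval s - v).
have nze : e != 0 by rewrite De subr_eq0.
have es : e *m GLval s = e.
  apply/eqP; rewrite -subr_eq0; apply/eqP.
  have vs1 x : x *m (GLval s - 1) = x *m GLval s - x.
    by rewrite mulmxBr -[1]/1%:M mulmx1.
  have : v *m ((GLval s - 1) ^+ 2) = 0 by rewrite ss mulmx0.
  by rewrite expr2 -[_ * _]/(_ *m _) mulmxA !vs1 -De.
have vs' : v *m GLval s = v + e by rewrite De addrC subrK.
have ee : b e e = 0.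
  have := bs v e; rewrite vs' es biscalarE => /eqP.
  by rewrite -subr_eq0 addrAC subrr add0r => /eqP.
have ev : b e v = 0.
  have : 2 * b e v = b (v + e) (v + e) - b v v.
    by rewrite !biscalarE ee (b_sym v e); ring.
  by rewrite -vs' bs subrr => /eqP; rewrite mulf_eq0 (negPf F2) => /eqP.
have rve : is_root b N a (v + 1 *: e).
  rewrite scale1r -vs'; apply: root_normalizer rv; first exact: Os.
  exact: subsetP nNG s Gs.
have sev := siegel_of_roots F2 b_sym nza primeF ee ev (oner_neq0 F) rv rve.
have [u ru nzue] : exists2 u, is_root b N a u & b u e != 0.
  have [/existsP[u /andP[ru ue]]|] :=
    boolP [exists u, is_root b N a u && (b u e != 0)]; first by exists u.
  rewrite negb_exists => /forallP orth_e; case/eqP: nze; apply: b_nondeg.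
  apply: root_span => [|x y xe ye|k x xe|u ru].
  - by rewrite biscalarE.
  - by rewrite biscalarE xe ye addr0.
  - by rewrite biscalarE xe mulr0.
  - by apply/eqP; have := orth_e u; rewrite ru negbK.
exact: frame_exists rv sev ru nzue.
Qed.

(** The spinor norm, or its product with the determinant according to the class
    of a, is 1 on the reflections of norm a and -1 on those of the other class. *)
Lemma reflection_shear_group :
  [\/ G = isom_group b :> {set GL}, G = spinor_kernel b :> {set GL}
    | G = spinor_det_kernel b :> {set GL}].
Proof.
have [e [f [w fr]]] := shear_frame.
have sieg_e := frame_siegel F2 b_sym sNb nza primeF F3 irrG primG sGb nNG b_nondeg fr.
have sieg_f := frame_siegel F2 b_sym sNb nza primeF F3 irrG primG sGb nNG b_nondeg
  (frameC b_sym fr).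
have [c nzc [class_ac classes]] := norm_class_exists F2 nza.
pose u0 : V := 1 *: e + (c / (2 * 1)) *: f.
have uu : b u0 u0 = c.
  by rewrite /u0 !biscalarE !(frameE b_sym fr); field.
have nzuu : b u0 u0 != 0 by rewrite uu.
have [r0 r0E] := involutive_GL (reflection_linear b u0) (reflectionK nzuu).
have nON : isom_group b \subset 'N(N)%g.
  apply/subsetP=> h Oh; rewrite inE /= -genJ gen_subG.
  apply/subsetP=> _ /imsetP[g /XP[_ [v vv gE]] ->].
  have /(norm_root F2 b_sym sNb nza primeF fr sieg_e sieg_f b_nondeg) :
    b (v *m GLval h) (v *m GLval h) = a by rewrite (isom_setP _ _ Oh).
  case/andP=> _ /realizedP[k Nk kE].
  have -> : (g ^ h)%g = k; last exact: Nk.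
  by apply: GL_ext => x; rewrite kE; apply: reflectionJ.
have cosets := orthogonal_cosets F2 b_sym sNb nza primeF fr sieg_e sieg_f b_nondeg
  nzc r0E classes nON.
have r0_refl := reflection_isP F2 b_sym nzuu r0E.
have Or0 : r0 \in isom_group b by case/andP: r0_refl => /and3P[].
have /and4P[_ thM th_refl _] := spinor_normP F2 b_perfect.
pose th := spinor_norm b.
have{}thM : {in isom_group b &, {morph th : g h / (g * h)%g >-> g * h}}.
  by move=> g h Og Oh; apply/eqP; have /forall_inP/(_ h Oh) := forall_inP thM g Og.
have{}th_refl (g : GL) v : b v v != 0 -> (forall x, x *m GLval g = reflection b v x) ->
    th g = square_class (b v v) /\ \det (GLval g) = -1.
  move=> nzv gE; have gv := reflection_isP F2 b_sym nzv gE; split.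
    by apply/eqP; have /forallP/(_ v)/implyP/(_ gv) := forallP th_refl g.
  by case/andP: gv => /and3P[_ _ /eqP].
have [thr0 detr0] := th_refl r0 u0 nzuu r0E; rewrite uu in thr0.
have thX g : g \in X -> th g = square_class a /\ \det (GLval g) = -1.
  by case/XP=> _ [v vv gE]; rewrite -vv; apply: th_refl; rewrite ?vv.
have [class_a | class_a] : square_class a = 1 \/ square_class a = -1.
  by rewrite /square_class; case: ifP; [left | right].
- have chiX : {in X, forall g, th g = 1} by move=> g /thX[->].
  have chir0 : th r0 = -1 by move: class_ac; rewrite thr0 class_a mul1r.
  have [->|->] := index_two_overgroup F2 thM sXG sGb Or0 chiX chir0 cosets.
    by constructor 1.
  by constructor 2.
pose chi (g : GL) : F := th g * \det (GLval g).
have chiM : {in isom_group b &, {morph chi : g h / (g * h)%g >-> g * h}}.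
  by move=> g h Og Oh; rewrite /chi thM // GL_MxE det_mulmx mulrACA.
have chiX : {in X, forall g, chi g = 1}.
  by move=> g /thX[thg detg]; rewrite /chi thg detg class_a mulrNN mulr1.
have chir0 : chi r0 = -1.
  have class_c : square_class c = 1 by move: class_ac; rewrite class_a mulN1r => /oppr_inj.
  by rewrite /chi thr0 detr0 class_c mul1r.
have [->|->] := index_two_overgroup F2 chiM sXG sGb Or0 chiX chir0 cosets.
  by constructor 1.
by constructor 3.
Qed.

End Assembly.

Theorem theorem1p1 (l : nat) (hl : prime l) (n : nat)
    (b : {biscalar 'rV['F_l]_n.+1}) (hb : perfect_pairing b)
    (G : {group {'GL_n.+1['F_l]}})
    (irrG : mx_irreducible (natural_repr G))
    (primG : mx_primitive (natural_repr G))
    (sGb : G \subset isom_group b) :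
  (symmetric_pairing b ->
   (exists2 g, g \in G & is_reflection b g) ->
   (exists2 g, g \in G & is_isotropic_shear b g) ->
   (5 <= l)%N ->
   [\/ G = isom_group b :> {set _},
       G = spinor_kernel b :> {set _}
     | G = spinor_det_kernel b :> {set _}])
  /\
  (alternating_pairing b ->
   (exists2 g, g \in G & is_transvection b g) ->
   (3 <= l)%N ->
   G = isom_group b :> {set _}).
Proof.
have primeF (k : 'F_l) : exists m : nat, k = m%:R by exists k; rewrite natr_Zp.
have small_neq0 m : (0 < m < l)%N -> m%:R != 0 :> 'F_l.
  case/andP=> m_gt0 m_lt; rewrite -(dvdn_pcharf (pchar_Fp hl)).
  by rewrite gtnNdvd.
have b_nondeg := perfect_nondegenerate hb.
split=> [b_sym [g Gg /and3P[Og /eqP drop1 _]] shear l5 | b_alt [g Gg] g_transv l3].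
  have F2 : 2 != 0 :> 'F_l by apply: small_neq0; apply: leq_trans l5.
  have F3 : 3 != 0 :> 'F_l by apply: small_neq0; apply: leq_trans l5.
  have [v nzv gE] := isom_drop1_reflection F2 b_sym b_nondeg Og drop1.
  apply: (reflection_shear_group F2 F3 primeF b_sym hb irrG primG sGb nzv) => //.
  by exists v => //; apply/realizedP; exists g.
have F2 : 2 != 0 :> 'F_l by apply: small_neq0.
apply: (primitive_transvection_group F2 primeF b_nondeg b_alt irrG primG sGb).
by exists g => //; case/and3P: g_transv => _ /eqP.
Qed.
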